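(* Let $S\subset\mathbb{R}^2$ be the von Koch snowflake. Then $$\mathrm{Dim}_{\mathcal{M}}(\partial S)=\mathrm{Dim}_F(\partial S)=\frac{\log4}{\log3},$$ i.e. (for the second dimension) $$P_s(S)<\infty\quad\forall\,s\in\Big(0,2-\frac{\log4}{\log3}\Big)\qquad\text{and}\qquad P_s(S)=\infty\quad\forall\,s\in\Big(2-\frac{\log4}{\log3},1\Big).$$
   Context: For $s\in(0,1)$ and measurable $E\subset\mathbb{R}^n$, $P_s(E):=\int_E\int_{\mathbb{R}^n\setminus E}\frac{dx\,dy}{|x-y|^{n+s}}$ (here $n=2$). Von Koch snowflake: start with a closed equilateral triangle $T$ of unit side. Replace the middle third of each side by the other two sides of the equilateral triangle erected outwards on it; repeat the same procedure on every segment of the polygonal curve obtained, and so on. The closed polygonal curves converge to a closed limit curve $\Sigma$, and $S$ is the bounded open region enclosed by $\Sigma$, so that $\partial S=\Sigma$. (Equivalently, up to a set of measure zero, $S=T\cup\bigcup_{k\ge1}T_k$, where $T_k$ is the union of the $3\cdot4^{k-1}$ equilateral triangles of side $3^{-k}$ added at step $k$.) Minkowski dimension of $\Gamma\subset\mathbb{R}^n$: with $\bar N_\rho(\Gamma)=\{x: d(x,\Gamma)\le\rho\}$, set $\underline{\mathcal{M}}^r(\Gamma)=\liminf_{\rho\to0}|\bar N_\rho(\Gamma)|\rho^{r-n}$ and $\overline{\mathcal{M}}^r(\Gamma)=\limsup_{\rho\to0}|\bar N_\rho(\Gamma)|\rho^{r-n}$ for $r\in[0,n]$; $\underline{\mathrm{Dim}}_{\mathcal{M}}(\Gamma)=\inf\{r\in[0,n]:\underline{\mathcal{M}}^r(\Gamma)=0\}$,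 $\overline{\mathrm{Dim}}_{\mathcal{M}}(\Gamma)=\sup\{r\in[0,n]:\overline{\mathcal{M}}^r(\Gamma)=\infty\}$; when they agree the common value is $\mathrm{Dim}_{\mathcal{M}}(\Gamma)$. Fractal dimension via the fractional perimeter: $\mathrm{Dim}_F(\partial E):=n-\sup\{s\in(0,1): P_s(E)<\infty\}$. *)

(* Defs.v *)
From mathcomp Require Import all_boot all_order all_algebra.
From mathcomp Require Import all_classical all_reals all_analysis.
Set Implicit Arguments.
Unset Strict Implicit.
Unset Printing Implicit Defensive.
Import Order.TTheory GRing.Theory Num.Theory.
Import numFieldNormedType.Exports.
Local Open Scope classical_set_scope.
Local Open Scope ring_scope.

(* The plane is [R * R] with its product topology.  The norm of the library on
   [R * R] is the sup norm, hence a separate Euclidean distance. *)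
Definition edist2 (R : realType) (x y : R * R) : R :=
  Num.sqrt ((x.1 - y.1) ^+ 2 + (x.2 - y.2) ^+ 2).

Notation leb2 R := (@lebesgue_measure R \x @lebesgue_measure R)%E.

Definition frontier (T : topologicalType) (A : set T) : set T :=
  closure A `\` interior A.

Definition frac_perimeter (R : realType) (s : R) (E : set (R * R)) : \bar R :=
  (\int[leb2 R]_(x in E) \int[leb2 R]_(y in ~` E)
     ((@edist2 R x y `^ (2 + s))^-1)%:E)%E.

(* Dim_F(\partial E), which depends on E and not only on its boundary. *)
Definition dimF (R : realType) (E : set (R * R)) : \bar R :=
  (2%:E - ereal_sup [set s%:E | s in
     [set s : R | (0 < s < 1)%R /\ frac_perimeter s E < +oo]])%E.

Definition dist_to (R : realType) (G : set (R * R)) (x : R * R) : \bar R :=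
  ereal_inf [set (edist2 x y)%:E | y in G].

Definition closed_nbhd (R : realType) (G : set (R * R)) (rho : R) :
  set (R * R) := [set x | (dist_to G x <= rho%:E)%E].

Definition lower_content (R : realType) (r : R) (G : set (R * R)) : \bar R :=
  limf_einf (fun rho : R => leb2 R (closed_nbhd G rho) * (rho `^ (r - 2))%:E)%E
    0^'+.

Definition upper_content (R : realType) (r : R) (G : set (R * R)) : \bar R :=
  limf_esup (fun rho : R => leb2 R (closed_nbhd G rho) * (rho `^ (r - 2))%:E)%E
    0^'+.

(* Valued in [\bar R], so that inf of the empty set is +oo and sup is -oo. *)
Definition lower_minkowski_dim (R : realType) (G : set (R * R)) : \bar R :=
  ereal_inf [set r%:E | r in
    [set r : R | 0 <= r <= 2 /\ lower_content r G = 0%E]].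

Definition upper_minkowski_dim (R : realType) (G : set (R * R)) : \bar R :=
  ereal_sup [set r%:E | r in
    [set r : R | 0 <= r <= 2 /\ upper_content r G = +oo%E]].

Definition has_minkowski_dim (R : realType) (G : set (R * R)) (d : \bar R) :
  Prop := lower_minkowski_dim G = d /\ upper_minkowski_dim G = d.

Definition rot_cw60 (R : realType) (v : R * R) : R * R :=
  (v.1 / 2 + Num.sqrt 3 / 2 * v.2, v.2 / 2 - Num.sqrt 3 / 2 * v.1).

(* The polygons are traversed counterclockwise, so that the outer side of a
   directed edge (a, b) is its right-hand side: the apex p of the triangle
   erected outwards on the middle third [a + u, b - u] is a + u plus the
   clockwise rotation of u. *)
Definition koch_step (R : realType) (e : (R * R) * (R * R)) :
    seq ((R * R) * (R * R)) :=
  let: (a, b) := e in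
  let u := 3^-1 *: (b - a) in
  let p := a + u + rot_cw60 u in
  [:: (a, a + u); (a + u, p); (p, b - u); (b - u, b)].

Definition triangle_edges (R : realType) : seq ((R * R) * (R * R)) :=
  let A := (0, 0) in let B := (1, 0) in let C := (2^-1, Num.sqrt 3 / 2) in
  [:: (A, B); (B, C); (C, A)].

Definition koch_edges (R : realType) (k : nat) : seq ((R * R) * (R * R)) :=
  iter k (fun es => flatten (map (@koch_step R) es)) (triangle_edges R).

Definition segment (R : realType) (a b : R * R) : set (R * R) :=
  [set a + t *: (b - a) | t in `[0, 1]].

Definition koch_polygon (R : realType) (k : nat) : set (R * R) :=
  [set x | exists2 e, e \in koch_edges R k & segment e.1 e.2 x].
Arguments koch_polygon : clear implicits.

(* Limit of the polygonal curves as sets: the limits of sequences of points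
   picked on the successive curves.  Each curve lies within 3^-(k+1) of the next
   and conversely, so this is also their limit for the Hausdorff distance. *)
Definition koch_curve (R : realType) : set (R * R) :=
  [set x | exists p : nat -> R * R,
     (forall k, koch_polygon R k (p k)) /\ p @ \oo --> x].
Arguments koch_curve : clear implicits.

(* [connected_component A x] is empty, hence bounded, when x is
   not in A, so the condition on x is needed. *)
Definition enclosed_region (R : realType) (G : set (R * R)) : set (R * R) :=
  [set x | ~ G x /\ bounded_set (connected_component (~` G) x)].

Definition snowflake (R : realType) : set (R * R) :=
  enclosed_region (koch_curve R).
Arguments snowflake : clear implicits.

(* Main.v *)
Require Import Defs.
From mathcomp Require Import all_boot all_order all_algebra.
From mathcomp Require Import all_classical all_reals all_analysis.
From mathcomp Require Import measurable_realfun ring lra.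
Import Order.TTheory GRing.Theory Num.Theory.
Import numFieldNormedType.Exports.
Local Open Scope classical_set_scope.
Local Open Scope ring_scope.

Set Implicit Arguments.
Unset Strict Implicit.
Unset Printing Implicit Defensive.

(** Write [d = ln 4 / ln 3].  A polygonal edge of length [3^-k] carries a flat
    triangle ([cap]) containing the part of the snowflake curve grown from that
    edge.  The caps of one generation have disjoint interiors, and the curve is
    the intersection over [k] of the unions of the [3 * 4^k] caps of generation
    [k].  Inside each cap the equilateral triangle added at the next step
    ([spike]) lies in the snowflake, and two smaller triangles ([notch]) lie in
    the unbounded component of the complement of the curve.

    Hence [c (4/9)^k <= |N_r(frontier S)| <= C (4/9)^k] when [r] is comparable to
    [3^-k], which gives the Minkowski dimension.  For the perimeter, the
    [3 * 4^k] pairs of boxes inside a spike and a neighbouring notch, of size and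
    at distance comparable to [3^-k], contribute at least
    [c 4^k 9^-2k 3^(k(2+s)) = c (4/9 * 3^s)^k], which is unbounded when
    [s > 2 - d].  Conversely, if [x] is in [S], [y] is not, and
    [|x - y| <= 3^-k], then [x] is within [3^-k] of the curve, so the pairs at
    distance comparable to [3^-k] contribute at most [C (4/9 * 3^s)^k], which is
    summable when [s < 2 - d]; the pairs at distance comparable to [3^k]
    contribute at most [C 3^(-sk)]. *)

(** * Coordinates relative to an edge *)

Section Coordinates.
Context {R : realType}.
Implicit Types (e : (R * R) * (R * R)) (x y z : R * R) (b : bool).

Local Notation w := (Num.sqrt 3 : R).

Lemma sqrt3_gt0 : 0 < w. Proof. by rewrite sqrtr_gt0. Qed.

Lemma sqrt3_sqr : w ^+ 2 = 3. Proof. by rewrite sqr_sqrtr. Qed.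

Definition vec e : R * R := (e.2.1 - e.1.1, e.2.2 - e.1.2).

Definition sqlen e : R := (vec e).1 ^+ 2 + (vec e).2 ^+ 2.

Definition sc e x : R :=
  ((x.1 - e.1.1) * (vec e).1 + (x.2 - e.1.2) * (vec e).2) / sqlen e.

Definition tc e x : R :=
  ((x.1 - e.1.1) * (vec e).2 - (x.2 - e.1.2) * (vec e).1) / (w * sqlen e).

(* The point [a + s v + t n], where [v = b - a] is the edge vector and [n] is
   [sqrt 3] times the outward normal obtained by rotating [v] clockwise by 90
   degrees.  With this factor all the vertices of the construction have rational
   coordinates.  [sc e] and [tc e] are the coordinate functions. *)
Definition pt e (s t : R) : R * R :=
  (e.1.1 + s * (vec e).1 + t * w * (vec e).2,
   e.1.2 + s * (vec e).2 - t * w * (vec e).1).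

Lemma sc_pt e s t : sqlen e != 0 -> sc e (pt e s t) = s.
Proof.
rewrite /sc /sqlen /pt /=; set v := vec e => h; have := sqrt3_gt0.
by move=> w0; field.
Qed.

Lemma tc_pt e s t : sqlen e != 0 -> tc e (pt e s t) = t.
Proof.
rewrite /tc /sqlen /pt /=; set v := vec e => h; have := sqrt3_gt0.
by move=> w0; field; rewrite h gt_eqF.
Qed.

Lemma pt_sc_tc e x : sqlen e != 0 -> pt e (sc e x) (tc e x) = x.
Proof.
case: x => x1 x2; rewrite /tc /sc /sqlen /pt /=; set v := vec e => h.
have := sqrt3_gt0.
by move=> w0; congr pair; field; rewrite h gt_eqF.
Qed.

(** These are the edges of [koch_step e]. The apex of an equilateral triangle of side one third has
    height [sqrt 3 / 6] in units of the edge length, hence second coordinate 1/6. *)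
Definition thirds e (i : nat) : (R * R) * (R * R) :=
  match i with
  | 0 => (e.1, pt e (1/3) 0)
  | 1 => (pt e (1/3) 0, pt e (1/2) (1/6))
  | 2 => (pt e (1/2) (1/6), pt e (2/3) 0)
  | _ => (pt e (2/3) 0, e.2)
  end.

Lemma koch_step_pt e : koch_step e = [seq thirds e i | i <- iota 0 4].
Proof.
case: e => -[a1 a2] [b1 b2] /=; rewrite /pt /vec /=.
have scE (k x : R) : k *: x = k * x by [].
congr [:: (_, (_, _)); ((_, _), (_, _)); ((_, _), (_, _)); ((_, _), _)];
  by rewrite /= ?scE; field.
Qed.

(* Coordinates relative to [e] of the point with coordinates [s], [t] relative
   to [thirds e i]. *)
Definition from_third (i : nat) (s t : R) : R * R :=
  match i with
  | 0 => (s / 3, t / 3)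
  | 1 => (1/3 + s / 6 - t / 2, s / 6 + t / 6)
  | 2 => (1/2 + s / 6 + t / 2, 1/6 - s / 6 + t / 6)
  | _ => (2/3 + s / 3, t / 3)
  end.

Lemma pt_thirds e i s t :
  pt (thirds e i) s t = pt e (from_third i s t).1 (from_third i s t).2.
Proof.
have w3 := sqrt3_sqr; case: e => -[a1 a2] [b1 b2].
by case: i => [|[|[|i]]]; rewrite /pt /vec /=; congr pair; field: w3.
Qed.

Lemma sqlen_thirds e i : sqlen (thirds e i) = sqlen e / 9.
Proof.
have w3 := sqrt3_sqr; case: e => -[a1 a2] [b1 b2].
by case: i => [|[|[|i]]]; rewrite /sqlen /vec /=; field: w3.
Qed.

(** The change of coordinates between an edge and its children is affine with rational coefficients,
    so relations between their caps, spikes and notches reduce to linear arithmetic. *)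
Lemma coords_thirds e i x : sqlen e != 0 ->
  let c := thirds e i in
  sc e x = (from_third i (sc c x) (tc c x)).1 /\
  tc e x = (from_third i (sc c x) (tc c x)).2.
Proof.
move=> e0 c; have c0 : sqlen c != 0 by rewrite sqlen_thirds mulf_neq0.
have E : x = pt e (from_third i (sc c x) (tc c x)).1
                  (from_third i (sc c x) (tc c x)).2.
  by rewrite -pt_thirds pt_sc_tc.
by rewrite [in sc e x]E [in tc e x]E sc_pt// tc_pt.
Qed.

Lemma continuous_sc e : continuous (sc e).
Proof.
move=> x; apply: cvgM; last exact: cvg_cst.
apply: cvgD; (apply: cvgM; last exact: cvg_cst);
  apply: cvgB; try exact: cvg_cst.
- exact: cvg_fst.
- exact: cvg_snd.
Qed.

Lemma continuous_tc e : continuous (tc e).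
Proof.
move=> x; apply: cvgM; last exact: cvg_cst.
apply: cvgB; (apply: cvgM; last exact: cvg_cst);
  apply: cvgB; try exact: cvg_cst.
- exact: cvg_fst.
- exact: cvg_snd.
Qed.

Lemma continuous_affine e (p q r : R) :
  continuous (fun x => p * sc e x + q * tc e x + r).
Proof.
move=> x; apply: cvgD; last exact: cvg_cst.
by apply: cvgD; apply: cvgM; (try exact: cvg_cst);
  [exact: continuous_sc | exact: continuous_tc].
Qed.

Lemma near_affine_gt0 e (p q r : R) z : 0 < p * sc e z + q * tc e z + r ->
  \forall y \near z, 0 < p * sc e y + q * tc e y + r.
Proof.
move=> h; have /= := @continuous_affine e p q r z.
by move=> /cvgr_gt; apply.
Qed.

End Coordinates.

(** * Caps *)

Section Caps.
Context {R : realType}.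
Implicit Types (e f : (R * R) * (R * R)) (x y z : R * R).

Lemma sc_line e x y (u : R) :
  sc e (x + u *: (y - x)) = sc e x + u * (sc e y - sc e x).
Proof.
have scE (k z : R) : k *: z = k * z by [].
by rewrite /sc /= !scE -[RHS]/(_ / _ + u * (_ / _ - _ / _)); ring.
Qed.

Lemma tc_line e x y (u : R) :
  tc e (x + u *: (y - x)) = tc e x + u * (tc e y - tc e x).
Proof.
have scE (k z : R) : k *: z = k * z by [].
by rewrite /tc /= !scE -[RHS]/(_ / _ + u * (_ / _ - _ / _)); ring.
Qed.

Lemma near_line (P : set (R * R)) x y : (\forall z \near x, P z) ->
  exists u : R, [/\ 0 < u, u <= 1 & P (x + u *: (y - x))].
Proof.
move=> Px; have c : (x + u *: (y - x)) @[u --> (0 : R)] --> x.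
  have : (x + u *: (y - x)) @[u --> (0 : R)] --> x + 0 *: (y - x).
    by apply: cvgD; [exact: cvg_cst | apply: cvgZr_tmp; exact: cvg_id].
  by rewrite scale0r addr0.
have /nbhs_ballP[d /= d0 dP] : \forall u \near (0 : R), P (x + u *: (y - x)).
  exact: (c _ Px).
exists (Num.min 1 (d / 2)); split.
- by rewrite lt_min ltr01 divr_gt0.
- by rewrite ge_min lexx.
- apply: dP; rewrite /ball /= sub0r normrN gtr0_norm ?lt_min ?ltr01 ?divr_gt0//.
  by rewrite gt_min ltr_pdivrMr// ltr_pMr// ltr1n orbT.
Qed.

(* The triangle with vertices [0, 0], [1, 0] and [1/2, 1/6]: its apex is the
   apex of the equilateral triangle erected on [e]. *)
Definition cap e : set (R * R) :=
  [set x | [/\ 0 <= tc e x, 3 * tc e x <= sc e x & 3 * tc e x <= 1 - sc e x]].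

Definition ocap e : set (R * R) :=
  [set x | [/\ 0 < tc e x, 3 * tc e x < sc e x & 3 * tc e x < 1 - sc e x]].

Lemma ocapW e : ocap e `<=` cap e.
Proof. by move=> x [? ? ?]; split; exact: ltW. Qed.

Lemma cap_thirds e i : sqlen e != 0 -> cap (thirds e i) `<=` cap e.
Proof.
move=> e0 x [h1 h2 h3]; have [] := coords_thirds i x e0.
rewrite /cap /=; set s := sc _ x in h1 h2 h3 *; set t := tc _ x in h1 h2 h3 *.
by case: i @s @t h1 h2 h3 => [|[|[|i]]] /= h1 h2 h3 -> ->; split; lra.
Qed.

Lemma ocap_thirds e i : sqlen e != 0 -> ocap (thirds e i) `<=` ocap e.
Proof.
move=> e0 x [h1 h2 h3]; have [] := coords_thirds i x e0.
rewrite /ocap /=; set s := sc _ x in h1 h2 h3 *; set t := tc _ x in h1 h2 h3 *.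
by case: i @s @t h1 h2 h3 => [|[|[|i]]] /= h1 h2 h3 -> ->; split; lra.
Qed.

Lemma ocap_thirds_inj e i j x : sqlen e != 0 -> (i < 4)%N -> (j < 4)%N ->
  ocap (thirds e i) x -> ocap (thirds e j) x -> i = j.
Proof.
move=> e0 i4 j4 [h1 h2 h3] [k1 k2 k3].
have [] := coords_thirds i x e0; have [] := coords_thirds j x e0.
set s := sc (thirds e i) x in h1 h2 h3 *; set t := tc (thirds e i) x in h1 h2 h3 *.
set s' := sc (thirds e j) x in k1 k2 k3 *;
  set t' := tc (thirds e j) x in k1 k2 k3 *.
move: s t s' t' h1 h2 h3 k1 k2 k3.
case: i i4 => [|[|[|[|//]]]] _; case: j j4 => [|[|[|[|//]]]] _ //= *; exfalso; lra.
Qed.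

Lemma ocap_ne e : sqlen e != 0 -> exists x, ocap e x.
Proof.
by move=> e0; exists (pt e (1/2) (1/12)); rewrite /ocap /= sc_pt// tc_pt//;
  split; lra.
Qed.

Lemma near_ocap e x : ocap e x -> \forall y \near x, ocap e y.
Proof.
move=> [h1 h2 h3].
have /near_affine_gt0 n1 : 0 < 0 * sc e x + 1 * tc e x + 0 by lra.
have /near_affine_gt0 n2 : 0 < 1 * sc e x + -3 * tc e x + 0 by lra.
have /near_affine_gt0 n3 : 0 < -1 * sc e x + -3 * tc e x + 1 by lra.
by apply: filterS3 n1 n2 n3 => y *; split; lra.
Qed.

(** Each defining inequality is weak at [x] and strict at [y], so a convex combination with positive
    weight on [y] is strict. *)
Lemma line_ocap f x y u : cap f x -> ocap f y -> 0 < u <= 1 ->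
  ocap f (x + u *: (y - x)).
Proof.
move=> [h1 h2 h3] [k1 k2 k3] u01; rewrite /ocap /= sc_line tc_line; split; nra.
Qed.

(* Move the common point towards an interior point of [cap f]. *)
Lemma disjoint_ocap_cap e f : sqlen f != 0 ->
  (forall x, ocap e x -> ocap f x -> False) ->
  forall x, ocap e x -> cap f x -> False.
Proof.
move=> f0 D x ex fx; have [y fy] := ocap_ne f0.
have [u [u0 u1 eu]] := near_line y (near_ocap ex).
by apply: (D _ eu); apply: line_ocap => //; rewrite u0.
Qed.

Lemma closed_affine_ge0 e (p q r : R) :
  closed [set x | 0 <= p * sc e x + q * tc e x + r].
Proof.
suff : closed ((fun x => p * sc e x + q * tc e x + r) @^-1` [set t | 0 <= t]) by [].
apply: closed_comp; last exact: closed_ge.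
by move=> z _; exact: continuous_affine.
Qed.

Lemma closed_cap e : closed (cap e).
Proof.
rewrite (_ : cap e = [set x | 0 <= 0 * sc e x + 1 * tc e x + 0] `&`
   [set x | 0 <= 1 * sc e x + -3 * tc e x + 0] `&`
   [set x | 0 <= -1 * sc e x + -3 * tc e x + 1]); last first.
  apply/seteqP; split=> x /=; rewrite /cap /=.
    by move=> [*]; split; [split|]; lra.
  by move=> [[*]]; split; lra.
by apply: closedI; [apply: closedI|]; exact: closed_affine_ge0.
Qed.

End Caps.

(** * The polygons and the limit curve *)

Section Edges.
Context {R : realType}.
Implicit Types (e f : (R * R) * (R * R)) (x y z : R * R) (k : nat).

Lemma koch_edgesS k :
  koch_edges R k.+1 = flatten [seq koch_step e | e <- koch_edges R k].
Proof. by []. Qed.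

Lemma koch_edgesSP k e : reflect
  (exists2 f, f \in koch_edges R k & exists2 i, (i < 4)%N & e = thirds f i)
  (e \in koch_edges R k.+1).
Proof.
rewrite koch_edgesS; apply: (iffP flatten_mapP) => -[f fk].
  rewrite koch_step_pt => /mapP[i]; rewrite mem_iota => i4 ->.
  by exists f => //; exists i.
by move=> [i i4 ->]; exists f => //; rewrite koch_step_pt map_f// mem_iota.
Qed.

Lemma size_koch_edges k : size (koch_edges R k) = (3 * 4 ^ k)%N.
Proof.
elim: k => [|k IH] //; rewrite koch_edgesS size_flatten /shape -map_comp.
rewrite (eq_map (g := fun=> 4%N)); last by case.
rewrite expnSr mulnA -IH; elim: (koch_edges R k) => //= e s ->.
by rewrite mulSn.
Qed.

Lemma sqlen_triangle e : e \in triangle_edges R -> sqlen e = 1.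
Proof.
have w3 := @sqrt3_sqr R.
by rewrite !inE => /or3P[] /eqP ->; rewrite /sqlen /vec /=; field: w3.
Qed.

Lemma sqlen_koch_edges k e : e \in koch_edges R k -> sqlen e = 9^-1 ^+ k.
Proof.
elim: k e => [|k IH] e; first by move/sqlen_triangle.
by move=> /koch_edgesSP[f /IH fk [i _ ->]]; rewrite sqlen_thirds fk exprSr.
Qed.

Lemma sqlen_koch_edges_neq0 k e : e \in koch_edges R k -> sqlen e != 0.
Proof. by move=> /sqlen_koch_edges ->; rewrite expf_neq0// invr_neq0. Qed.

Definition side (i : nat) : (R * R) * (R * R) :=
  nth ((0, 0), (1, 0)) (triangle_edges R) i.

Lemma side_in i : (i < 3)%N -> side i \in koch_edges R 0.
Proof. by move=> i3; exact: (@mem_nth _ _ (triangle_edges R)). Qed.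

Lemma sideP e : reflect (exists2 i, (i < 3)%N & e = side i) (e \in koch_edges R 0).
Proof.
apply: (iffP idP) => [|[i i3 ->]]; last exact: side_in.
by move=> /(nthP ((0, 0), (1, 0)))[i i3 <-]; exists i.
Qed.

(** The three sides are compared through the coordinates of side 0, which makes every statement
    about the base triangle linear. *)
Lemma coords_side x :
  [/\ sc (side 0) x = 1 - sc (side 1) x / 2 + 3 * tc (side 1) x / 2,
      tc (side 0) x = - sc (side 1) x / 2 - tc (side 1) x / 2,
      sc (side 0) x = 1 / 2 - sc (side 2) x / 2 - 3 * tc (side 2) x / 2 &
      tc (side 0) x = - 1 / 2 + sc (side 2) x / 2 - tc (side 2) x / 2].
Proof.
have w3 := @sqrt3_sqr R.
have s0 i : (i < 3)%N -> sqlen (side i) != 0.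
  by move=> /side_in/sqlen_koch_edges_neq0.
have E1 s t : pt (side 1) s t = pt (side 0) (1 - s / 2 + 3 * t / 2) (- s / 2 - t
  / 2).
  by rewrite /pt /vec /=; congr pair; field: w3.
have E2 s t : pt (side 2) s t =
    pt (side 0) (1 / 2 - s / 2 - 3 * t / 2) (- 1 / 2 + s / 2 - t / 2).
  by rewrite /pt /vec /=; congr pair; field: w3.
have := pt_sc_tc x (s0 1%N isT); rewrite E1 => /esym X1.
have := pt_sc_tc x (s0 2%N isT); rewrite E2 => /esym X2.
split.
- by rewrite {1}X1 sc_pt ?s0.
- by rewrite {1}X1 tc_pt ?s0.
- by rewrite {1}X2 sc_pt ?s0.
- by rewrite {1}X2 tc_pt ?s0.
Qed.

Definition cover k : set (R * R) :=
  [set x | exists2 e, e \in koch_edges R k & cap e x].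

Lemma cover_subset j k : (j <= k)%N -> cover k `<=` cover j.
Proof.
move=> /subnK <-; elim: (k - j)%N => // n IH x; rewrite addSn.
move=> [_ /koch_edgesSP[f fk [i _ ->]] fx]; apply: IH; exists f => //.
by apply: cap_thirds fx; exact: sqlen_koch_edges_neq0 fk.
Qed.

Lemma closed_cover k : closed (cover k).
Proof.
rewrite (_ : cover k = \big[setU/set0]_(e <- koch_edges R k) cap e).
  by apply: closed_bigsetU => e _; exact: closed_cap.
by rewrite -bigcup_seq; apply/seteqP; split=> x [e ? ?]; exists e.
Qed.

Lemma mem_segment e x : sqlen e != 0 ->
  segment e.1 e.2 x <-> tc e x = 0 /\ 0 <= sc e x <= 1.
Proof.
have scE (k z : R) : k *: z = k * z by [].
have E u : e.1 + u *: (e.2 - e.1) = pt e u 0.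
  case: e => -[a1 a2] [b1 b2]; rewrite /pt /vec /=.
  by congr pair; rewrite /= scE; ring.
move=> e0; split=> [[u] /=|[t0 s01]].
  by rewrite in_itv /= E => u01 <-; rewrite tc_pt// sc_pt.
by exists (sc e x); [rewrite /= in_itv | rewrite E; have := pt_sc_tc x e0;
  rewrite t0].
Qed.

Lemma koch_polygonP k x : koch_polygon R k x <->
  exists2 e, e \in koch_edges R k & tc e x = 0 /\ 0 <= sc e x <= 1.
Proof.
split=> -[e ek] h; exists e => //.
  by apply/mem_segment => //; exact: sqlen_koch_edges_neq0 ek.
by apply/mem_segment => //; exact: sqlen_koch_edges_neq0 ek.
Qed.

Lemma koch_polygon_cover k : koch_polygon R k `<=` cover k.
Proof.
by move=> x /koch_polygonP[e ek [t0 s01]]; exists e => //; rewrite /cap /= t0;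
  split; lra.
Qed.

Lemma ocap_side_inj i j x : (i < 3)%N -> (j < 3)%N ->
  ocap (side i) x -> ocap (side j) x -> i = j.
Proof.
move=> i3 j3 [h1 h2 h3] [k1 k2 k3]; have [E1 E2 E3 E4] := coords_side x.
case: i i3 h1 h2 h3 => [|[|[|//]]] _ h1 h2 h3;
  case: j j3 k1 k2 k3 => [|[|[|//]]] _ k1 k2 k3 //; exfalso; lra.
Qed.

(** Open caps of children lie in those of their parents, so by induction the parents agree; siblings
    are then separated by [ocap_thirds_inj]. *)
Lemma ocap_koch_edges_inj k e f x : e \in koch_edges R k ->
  f \in koch_edges R k -> ocap e x -> ocap f x -> e = f.
Proof.
elim: k e f x => [|k IH] e f x.
  by move=> /sideP[i i3 ->] /sideP[j j3 ->] ex /(ocap_side_inj i3 j3 ex) ->.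
move=> /koch_edgesSP[e' ek [i i4 ->]] /koch_edgesSP[f' fk [j j4 ->]] ex fx.
have e0 := sqlen_koch_edges_neq0 ek; have f0 := sqlen_koch_edges_neq0 fk.
have ef := IH _ _ _ ek fk (ocap_thirds e0 ex) (ocap_thirds f0 fx).
by move: fx; rewrite -ef => fx; rewrite (ocap_thirds_inj e0 i4 j4 ex fx).
Qed.

(** A repeated edge would give two positions the same open cap, which is nonempty, while open caps
    at distinct positions are disjoint. *)
Lemma uniq_koch_edges k : uniq (koch_edges R k).
Proof.
elim: k => [|k IH].
  rewrite (_ : koch_edges R 0 = [seq side i | i <- iota 0 3])//.
  rewrite map_inj_in_uniq ?iota_uniq// => i j; rewrite !mem_iota => i3 j3 ij.
  have [x ex] := ocap_ne (sqlen_koch_edges_neq0 (side_in i3)).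
  by apply: (ocap_side_inj i3 j3 ex); rewrite -ij.
rewrite koch_edgesS.
(* The induction runs over a list whose members remain known to be edges of generation [k], so that
   disjointness of caps applies to them. *)
have [s sub us] : exists2 s, {subset s <= koch_edges R k} /\ uniq s &
    s = koch_edges R k.
  by exists (koch_edges R k) => //; split.
rewrite -us; case: sub; elim: s {us} => //= e s IHs sub /andP[es us].
have ek : e \in koch_edges R k by apply: sub; rewrite mem_head.
have e0 := sqlen_koch_edges_neq0 ek.
rewrite cat_uniq IHs ?andbT//; last by move=> f fs; apply: sub;
  rewrite in_cons fs orbT.
apply/andP; split.
  rewrite koch_step_pt map_inj_in_uniq ?iota_uniq// => i j;
    rewrite !mem_iota => i4 j4 ij.
  have [x ex] : exists x, ocap (thirds e i) x.
    by apply: ocap_ne; rewrite sqlen_thirds mulf_neq0.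
  by apply: (ocap_thirds_inj e0 i4 j4 ex); rewrite -ij.
apply/hasPn => g /flatten_mapP[f fs]; rewrite koch_step_pt => /mapP[j _ ->{g}].
apply/negP; rewrite koch_step_pt => /mapP[i _ ij].
have fk : f \in koch_edges R k by apply: sub; rewrite in_cons fs orbT.
have f0 := sqlen_koch_edges_neq0 fk.
have [x ex] : exists x, ocap (thirds f j) x.
  by apply: ocap_ne; rewrite sqlen_thirds mulf_neq0.
have ef : e = f.
  by apply: (ocap_koch_edges_inj ek fk _ (ocap_thirds f0 ex));
    apply: (ocap_thirds e0 (i := i)); rewrite -ij.
by rewrite ef fs in es.
Qed.

Lemma sqlen_koch_edgesE k e : e \in koch_edges R k -> sqlen e = (3^-1 ^+ k) ^+ 2.
Proof.
move=> /sqlen_koch_edges ->; rewrite exprAC; congr (_ ^+ _).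
by rewrite exprVn -natrX.
Qed.

Lemma sqr_edist2 x y : edist2 x y ^+ 2 = (x.1 - y.1) ^+ 2 + (x.2 - y.2) ^+ 2.
Proof. by rewrite sqr_sqrtr// addr_ge0 ?sqr_ge0. Qed.

Lemma sqr_edist2_coords e x y : sqlen e != 0 -> edist2 x y ^+ 2 =
  sqlen e * ((sc e x - sc e y) ^+ 2 + 3 * (tc e x - tc e y) ^+ 2).
Proof.
move=> e0; rewrite sqr_edist2 -{1 2}(pt_sc_tc x e0) -{1 2}(pt_sc_tc y e0).
by rewrite /pt /sqlen /=; ring: (@sqrt3_sqr R).
Qed.

Lemma edist2_ge0 x y : 0 <= edist2 x y.
Proof. exact: sqrtr_ge0. Qed.

Lemma norm_le_edist2 x y : `|x - y| <= edist2 x y.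
Proof.
rewrite prod_normE /= ge_max -!sqrtr_sqr.
by rewrite !ler_wsqrtr// ?lerDl ?lerDr sqr_ge0.
Qed.

Lemma edist2_le_norm x y : edist2 x y <= 2 * `|x - y|.
Proof.
have h1 : `|x.1 - y.1| <= `|x - y| by rewrite prod_normE /= le_max lexx.
have h2 : `|x.2 - y.2| <= `|x - y| by rewrite prod_normE /= le_max lexx orbT.
have N0 : 0 <= `|x - y| by exact: normr_ge0.
move: `|x - y| h1 h2 N0 => N; rewrite !ler_norml => /andP[? ?] /andP[? ?] N0.
rewrite -ler_sqr ?nnegrE ?edist2_ge0 ?mulr_ge0// sqr_edist2; nra.
Qed.

(** Within a cap the two coordinates vary by at most 1 and 1/6, so the squared distance is at most
    [1 + 3 / 36] times [sqlen e]; the factor 2 is generous. *)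
Lemma edist2_cap k e x y : e \in koch_edges R k -> cap e x -> cap e y ->
  edist2 x y <= 2 * 3^-1 ^+ k.
Proof.
move=> ek [h1 h2 h3] [k1 k2 k3]; have e0 := sqlen_koch_edges_neq0 ek.
rewrite -ler_sqr ?nnegrE ?edist2_ge0 ?mulr_ge0 ?exprn_ge0 ?invr_ge0//.
rewrite (sqr_edist2_coords _ _ e0) (sqlen_koch_edgesE ek) exprMn [leRHS]mulrC.
rewrite ler_wpM2l ?sqr_ge0//; nra.
Qed.

Lemma sc_start e : sc e e.1 = 0.
Proof. by rewrite /sc !subrr !mul0r addr0 mul0r. Qed.

Lemma tc_start e : tc e e.1 = 0.
Proof. by rewrite /tc !subrr !mul0r subr0 mul0r. Qed.

Lemma start_cap e : cap e e.1.
Proof. by rewrite /cap /= sc_start tc_start; split; lra. Qed.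

Lemma start_polygon k e : e \in koch_edges R k -> koch_polygon R k e.1.
Proof.
move=> ek; exists e => //; exists 0; first by rewrite /= in_itv /= lexx ler01.
by rewrite scale0r addr0.
Qed.

(** A limit of points of the polygons stays in each closed [cover k], which contains all later
    polygons. Conversely, a point in every cover is the limit of the starting points of the edges
    whose caps contain it. *)
Lemma koch_curveE : koch_curve R = \bigcap_k cover k.
Proof.
apply/seteqP; split=> x.
  move=> [p [pk px]] k _; apply: (closed_cvg _ (@closed_cover k)) px.
  exists k => // j kj; exact/(cover_subset kj)/koch_polygon_cover.
move=> xk.
have /choice[p pP] k : exists y, koch_polygon R k y /\ `|x - y| <= 2 * 3^-1 ^+ k.
  have [e ek ex] := xk k I.
  exists e.1; split; first exact: start_polygon.
  by apply: le_trans (norm_le_edist2 _ _) (edist2_cap ek ex (start_cap e)).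
exists p; split; first by move=> k; case: (pP k).
have := @cvg_geometric R 2 3^-1 _.
rewrite gtr0_norm ?invr_gt0// invf_lt1// ltr1n => /(_ isT) g.
apply/cvgrPdist_le => d d0.
have : \forall n \near \oo, geometric 2 3^-1 n < d by move/cvgr_lt : g; apply.
apply: filterS => n nd; apply: le_trans (ltW nd); by have [] := pP n.
Qed.

Lemma closed_koch_curve : closed (koch_curve R).
Proof. by rewrite koch_curveE; apply: closed_bigI => k _; exact: closed_cover. Qed.

Lemma koch_curve_cover k x : koch_curve R x -> cover k x.
Proof. by rewrite koch_curveE; apply. Qed.

End Edges.

(** * Components of the complement of a closed set *)

Section Plane.
Context {R : realType}.
Implicit Types (x y z : R * R) (A G V W : set (R * R)).

Lemma segment_connected x y : connected (segment x y).
Proof.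
apply: connected_continuous_connected.
  by apply/connected_intervalP; exact: interval_is_interval.
apply: continuous_subspaceT => u.
apply: cvgD; [exact: cvg_cst | apply: cvgZr_tmp; exact: cvg_id].
Qed.

Lemma segment_start x y : segment x y x.
Proof. by exists 0; [rewrite /= in_itv /= lexx ler01 | rewrite scale0r addr0]. Qed.

Lemma segment_end x y : segment x y y.
Proof.
exists 1; first by rewrite /= in_itv /= lexx ler01.
by rewrite scale1r addrC subrK.
Qed.

Lemma segment_norm x y z : segment x y z -> `|x - z| <= `|x - y|.
Proof.
move=> [u]; rewrite /= in_itv /= => /andP[u0 u1] <-.
rewrite opprD addNKr normrN -opprB scalerN normrN normrZ ger0_norm//.
by rewrite ler_piMl.
Qed.

Lemma segment_component G x y : segment x y `<=` ~` G ->
  connected_component (~` G) x = connected_component (~` G) y.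
Proof.
move=> s; apply: same_connected_component.
apply: (connected_component_max _ s _ (segment_end x y)).
  exact: segment_start.
exact: segment_connected.
Qed.

Lemma enclosed_segment G x y : segment x y `<=` ~` G ->
  enclosed_region G x <-> enclosed_region G y.
Proof.
move=> s; rewrite /enclosed_region /= (segment_component s).
split=> -[_ b]; split=> //.
- exact: (s _ (segment_end x y)).
- exact: (s _ (segment_start x y)).
Qed.

Lemma near_segment (P : set (R * R)) x : (\forall z \near x, P z) ->
  \forall y \near x, segment x y `<=` P.
Proof.
move=> /nbhs_normP[d /= d0 dP]; apply/nbhs_normP; exists d => //= y xy z.
by move=> /segment_norm xz; apply: dP; exact: le_lt_trans xz xy.
Qed.

Lemma near_notin G x : closed G -> ~ G x -> \forall y \near x, ~ G y.
Proof. by move=> cG Gx; have : open (~` G) by [exact: closed_openC];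
  rewrite openE; apply. Qed.

(** Off [G], all nearby points are joined to [x] by segments avoiding [G], so they are all enclosed
    or all not enclosed. *)
Lemma frontier_enclosed G : closed G -> frontier (enclosed_region G) `<=` G.
Proof.
move=> cG x [clx nix]; apply: contrapT => Gx.
have N : \forall y \near x, segment x y `<=` ~` G by apply/near_segment/near_notin.
apply: nix; have [y [Sy /enclosed_segment sy]] := clx _ N.
by apply: filterS N => z /enclosed_segment <-; exact/sy.
Qed.

(** If the segment missed the frontier, its trace on [A] would be relatively open (cut out by the
    interior) and closed (cut out by the closure), hence the whole segment. *)
Lemma segment_frontier A x y : A x -> ~ A y ->
  exists2 z, segment x y z & frontier A z.
Proof.
move=> Ax Ay; apply: contrapT => N.
have E : segment x y `&` A = segment x y.
  apply: segment_connected.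
  - by exists x; split=> //; exact: segment_start.
  - exists (interior A); first exact: open_interior.
    apply/seteqP; split=> z [sz Az]; split=> //; last exact: interior_subset.
    apply: contrapT => iz; apply: N; exists z => //; split=> //.
    exact: subset_closure.
  - exists (closure A); first exact: closed_closure.
    apply/seteqP; split=> z [sz Az]; split=> //; first exact: subset_closure.
    apply: contrapT => iz; apply: N; exists z => //; split=> // /interior_subset.
    exact: iz.
by apply: Ay; have := segment_end x y; rewrite -E => -[].
Qed.

(** Inside the component of a point of [V], the set [V] is relatively open and, being the complement
    of [W] there, relatively closed; so the component stays in the bounded [V]. *)
Lemma clopen_enclosed G V W : open V -> open W -> V `&` W = set0 ->
  V `|` W = ~` G -> bounded_set V -> V `<=` enclosed_region G.
Proof.
move=> oV oW VW0 VWG bV x Vx.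
have Gx : ~ G x by rewrite -[~ G x]/((~` G) x) -VWG; left.
split=> //; suff: connected_component (~` G) x `<=` V.
  move=> s; case: bV => M [Mr MV]; exists M; split=> // N MN y /s; exact: MV.
have CG : connected_component (~` G) x `<=` ~` G by exact: connected_component_sub.
have <- : connected_component (~` G) x `&` V = connected_component (~` G) x.
  apply: component_connected.
  - by exists x; split=> //; exact: connected_component_refl.
  - by exists V.
  - exists (~` W); first exact: open_closedC.
    apply/seteqP; split=> z [Cz]; split=> //.
      by move=> Wz; rewrite -[False]/(set0 z) -VW0.
    by have := CG _ Cz; rewrite -VWG => -[].
by move=> z [].
Qed.

(** The whole ray lies in the component of [x], which is therefore unbounded. *)
Lemma ray_notin_enclosed G x w : w != 0 ->
  (forall u, 0 <= u -> ~ G (x + u *: w)) -> ~ enclosed_region G x.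
Proof.
move=> w0 Gw [Gx]; rewrite /bounded_set => -[M [Mr MC]].
have C u : 0 <= u -> connected_component (~` G) x (x + u *: w).
  move=> u0; rewrite (@segment_component _ _ (x + u *: w)).
    by apply: connected_component_refl; exact: Gw.
  move=> z [v]; rewrite /= in_itv /= => /andP[v0 _] <-.
  by rewrite [x + u *: w]addrC addrK scalerA; apply: Gw; rewrite mulr_ge0.
pose N := `|M| + 1; have MN : M < N by rewrite ltr_pwDr// ler_norm.
(* With this [u] the vector [u *: w] has norm [N + 1 + |x|], so the point of the ray has norm at
   least [N + 1]. *)
pose u := (N + 1 + `|x|) / `|w|.
have nw : 0 < `|w| by rewrite normr_gt0.
have u0 : 0 <= u by rewrite divr_ge0// !addr_ge0.
have := MC N MN _ (C u u0); apply/negP; rewrite -ltNge.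
have : `|u *: w| <= `|x + u *: w| + `|x|.
  by rewrite -{1}(addKr x (u *: w)) addrC; exact: ler_normB.
by rewrite normrZ ger0_norm// divfK ?gt_eqF//; lra.
Qed.

End Plane.

(** * Points inside the snowflake *)

Section Inside.
Context {R : realType}.
Implicit Types (e f : (R * R) * (R * R)) (x y z : R * R) (k : nat).

(** Caps grown from other edges lie in caps disjoint from [ocap e], so only the four children of [e]
    have to be checked. *)
Lemma ocap_notin_cover k e x : e \in koch_edges R k -> ocap e x ->
  (forall i, (i < 4)%N -> ~ cap (thirds e i) x) -> ~ cover k.+1 x.
Proof.
move=> ek ex N [_ /koch_edgesSP[f fk [i i4 ->]] fx].
have [ef|nef] := eqVneq e f; first by rewrite -ef in fx; exact: (N i i4).
have f0 := sqlen_koch_edges_neq0 fk.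
apply: (disjoint_ocap_cap f0 _ ex (cap_thirds f0 fx)) => y ey fy.
by move/eqP: nef; apply; exact: (ocap_koch_edges_inj ek fk ey fy).
Qed.

Definition spike e : set (R * R) :=
  [set x | [/\ 0 <= tc e x, tc e x <= sc e x - 1 / 3 & tc e x <= 2 / 3 - sc e x]].

Definition ospike e : set (R * R) :=
  [set x | [/\ 0 < tc e x, tc e x < sc e x - 1 / 3 & tc e x < 2 / 3 - sc e x]].

Lemma ospike_ocap e : ospike e `<=` ocap e.
Proof. by move=> x [h1 h2 h3]; split; lra. Qed.

Lemma ospike_spike e : ospike e `<=` spike e.
Proof. by move=> x [h1 h2 h3]; split; lra. Qed.

Lemma spike_cap e : spike e `<=` cap e.
Proof. by move=> x [h1 h2 h3]; split; lra. Qed.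

Lemma near_ospike e x : ospike e x -> \forall y \near x, ospike e y.
Proof.
move=> [h1 h2 h3].
have /near_affine_gt0 n1 : 0 < 0 * sc e x + 1 * tc e x + 0 by lra.
have /near_affine_gt0 n2 : 0 < 1 * sc e x + -1 * tc e x + -1 / 3 by lra.
have /near_affine_gt0 n3 : 0 < -1 * sc e x + -1 * tc e x + 2 / 3 by lra.
by apply: filterS3 n1 n2 n3 => y *; split; lra.
Qed.

Lemma closed_spike e : closed (spike e).
Proof.
rewrite (_ : spike e = [set x | 0 <= 0 * sc e x + 1 * tc e x + 0] `&`
   [set x | 0 <= 1 * sc e x + -1 * tc e x + -1 / 3] `&`
   [set x | 0 <= -1 * sc e x + -1 * tc e x + 2 / 3]); last first.
  apply/seteqP; split=> x /=; rewrite /spike /=.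
    by move=> [*]; split; [split|]; lra.
  by move=> [[*]]; split; lra.
by apply: closedI; [apply: closedI|]; exact: closed_affine_ge0.
Qed.

Definition base_triangle : set (R * R) :=
  [set x | forall i, (i < 3)%N -> tc (side i) x <= 0].

Lemma closed_base_triangle : closed base_triangle.
Proof.
rewrite (_ : base_triangle = \bigcap_(i in [set i | (i < 3)%N])
   [set x | 0 <= 0 * sc (side i) x + -1 * tc (side i) x + 0]).
  by apply: closed_bigI => i _; exact: closed_affine_ge0.
by apply/seteqP; split=> x /= h i /= i3; have := h i i3; rewrite /=; lra.
Qed.

(* The closed region bounded by the [k]-th polygon. *)
Fixpoint fill k : set (R * R) :=
  if k is j.+1 then fill j `|` [set x | exists2 e, e \in koch_edges R j & spike e x]
  else base_triangle.

Lemma closed_fill k : closed (fill k).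
Proof.
elim: k => [|k IH]; first exact: closed_base_triangle.
apply: closedU => //.
rewrite (_ : [set x | _] = \big[setU/set0]_(e <- koch_edges R k) spike e).
  by apply: closed_bigsetU => e _; exact: closed_spike.
by rewrite -bigcup_seq; apply/seteqP; split=> x [e ? ?]; exists e.
Qed.

Lemma fill_subset j k : (j <= k)%N -> fill j `<=` fill k.
Proof.
by move=> /subnK <-; elim: (k - j)%N => // n IH x /IH; rewrite addSn; left.
Qed.

(** Every spike added from generation [j] on lies in a cap of generation [j]. *)
Lemma fill_stable j k x : (j <= k)%N -> fill k x -> ~ cover j x -> fill j x.
Proof.
move=> /subnK <-; elim: (k - j)%N => // n IH;
  rewrite addSn => -[|[e en /spike_cap ex] []].
  exact: IH.
by apply: (cover_subset (leq_addl n j)); exists e.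
Qed.

(** By induction: the two outer thirds of an edge inherit the property from it, while the two middle
    edges have the new spike on their left. *)
Lemma fill_left k e z : e \in koch_edges R k -> tc e z = 0 -> 0 < sc e z < 1 ->
  \forall y \near z, tc e y <= 0 -> fill k y.
Proof.
elim: k e z => [|k IH] e z.
  move=> /sideP[i i3 ->] t0 s01; have [E1 E2 E3 E4] := coords_side z.
  (* At an interior point of side [i] the inequalities of the other two sides are strict, hence
     persist nearby. *)
  have N j : (j < 3)%N -> \forall y \near z, tc (side i) y <= 0 -> tc (side j) y
    <= 0.
    move=> j3; have [->|ij] := eqVneq j i; first by apply: (@filterE _ (nbhs z)).
    have /near_affine_gt0 : 0 < 0 * sc (side j) z + -1 * tc (side j) z + 0.
      by case: i i3 t0 s01 ij => [|[|[|//]]] _ t0 s01;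
        case: j j3 => [|[|[|//]]] _ // _; lra.
    by apply: filterS => y *; lra.
  apply: filterS3 (N 0%N isT) (N 1%N isT) (N 2%N isT) => y h0 h1 h2 t j.
  by case: j => [|[|[|//]]] _; [exact: h0|exact: h1|exact: h2].
move=> /koch_edgesSP[f fk [i i4 ->{e}]] t0 s01; have f0 := sqlen_koch_edges_neq0 fk.
have C y := coords_thirds i y f0.
have inherit : tc f z = 0 -> 0 < sc f z < 1 ->
    (forall y, tc (thirds f i) y <= 0 -> tc f y <= 0) ->
    \forall y \near z, tc (thirds f i) y <= 0 -> fill k.+1 y.
  by move=> tf sf H; apply: filterS (IH f z fk tf sf) => y Hy /H/Hy; left.
have new (p q r p' q' r' : R) : 0 < p * sc f z + q * tc f z + r ->
    0 < p' * sc f z + q' * tc f z + r' ->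
    (forall y, 0 < p * sc f y + q * tc f y + r -> 0 < p' * sc f y + q' * tc f y +
      r' ->
       tc (thirds f i) y <= 0 -> spike f y) ->
    \forall y \near z, tc (thirds f i) y <= 0 -> fill k.+1 y.
  move=> /near_affine_gt0 n1 /near_affine_gt0 n2 H.
  by apply: filterS2 n1 n2 => y h1 h2 h3; right; exists f => //; exact: H.
case: i i4 t0 s01 C inherit new => [|[|[|[|//]]]] _ t0 s01 C inherit new.
- by apply: inherit => [||y h]; [have := C z|have := C z|have := C y];
  rewrite /= => -[E1 E2]; lra.
- apply: (new 0 1 0 (-1) (-1) (2/3)) => [||y h1 h2 h3].
  + by have := C z; rewrite /= => -[E1 E2]; lra.
  + by have := C z; rewrite /= => -[E1 E2]; lra.
  + by have := C y; rewrite /= => -[E1 E2]; split; lra.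
- apply: (new 0 1 0 1 (-1) (-1/3)) => [||y h1 h2 h3].
  + by have := C z; rewrite /= => -[E1 E2]; lra.
  + by have := C z; rewrite /= => -[E1 E2]; lra.
  + by have := C y; rewrite /= => -[E1 E2]; split; lra.
- by apply: inherit => [||y h]; [have := C z|have := C z|have := C y];
  rewrite /= => -[E1 E2]; lra.
Qed.

Lemma polygon_thirds k e i x : e \in koch_edges R k -> (i < 4)%N ->
  tc (thirds e i) x = 0 -> 0 <= sc (thirds e i) x <= 1 -> koch_polygon R k.+1 x.
Proof.
move=> ek i4 t0 s01; apply/koch_polygonP; exists (thirds e i) => //.
by apply/koch_edgesSP; exists e => //; exists i.
Qed.

Lemma near_middle_third k e x : e \in koch_edges R k -> tc e x = 0 ->
  1 / 3 < sc e x < 2 / 3 -> \forall y \near x, fill k.+1 y.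
Proof.
move=> ek t0 s01; have s01' : 0 < sc e x < 1 by lra.
have /near_affine_gt0 n1 : 0 < 1 * sc e x + -1 * tc e x + -1 / 3 by lra.
have /near_affine_gt0 n2 : 0 < -1 * sc e x + -1 * tc e x + 2 / 3 by lra.
apply: filterS3 n1 n2 (fill_left ek t0 s01') => y h1 h2 fy.
have [/fy|ty] := leP (tc e y) 0; first by left.
by right; exists e => //; split; lra.
Qed.

(* The boundary of [fill k] lies on the polygon: a middle third removed from the
   polygon has [fill k] on its left and a spike on its right. *)
Lemma near_fill k x : fill k x -> ~ koch_polygon R k x ->
  \forall y \near x, fill k y.
Proof.
elim: k x => [|k IH] x.
  move=> Tx px.
  have N i : (i < 3)%N -> \forall y \near x, tc (side i) y <= 0.
    move=> i3; have := Tx i i3; rewrite le_eqVlt => /orP[/eqP t0|tn].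
      exfalso; apply: px; apply/koch_polygonP; exists (side i);
        first exact: side_in.
      split=> //; have [E1 E2 E3 E4] := coords_side x.
      have := Tx 0%N isT; have := Tx 1%N isT; have := Tx 2%N isT.
      by case: i i3 t0 => [|[|[|//]]] _ t0 *; lra.
    have /near_affine_gt0 : 0 < 0 * sc (side i) x + -1 * tc (side i) x + 0 by lra.
    by apply: filterS => y *; lra.
  apply: filterS3 (N 0%N isT) (N 1%N isT) (N 2%N isT) => y h0 h1 h2 i.
  by case: i => [|[|[|//]]].
move=> fx px.
(* The outer thirds of an edge survive in the next polygon, so a point of the edge off that polygon
   lies in the open middle third. *)
have mid e : e \in koch_edges R k -> tc e x = 0 -> 0 <= sc e x <= 1 ->
    \forall y \near x, fill k.+1 y.
  move=> ek t0 s01; have e0 := sqlen_koch_edges_neq0 ek.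
  have P0 := polygon_thirds (i := 0) (x := x) ek isT.
  have P3 := polygon_thirds (i := 3) (x := x) ek isT.
  have := coords_thirds 0 x e0; have := coords_thirds 3 x e0 => /= -[E1 E2] [E3 E4].
  have [s1|s1] := leP (sc e x) (1 / 3); first by exfalso; apply/px/P0; lra.
  have [s2|s2] := leP (2 / 3) (sc e x); first by exfalso; apply/px/P3; lra.
  by apply: (near_middle_third ek t0); rewrite s1.
case: fx => [fx|[e ek [h1 h2 h3]]].
  have [/koch_polygonP[e ek [t0 s01]]|pk] := pselect (koch_polygon R k x).
    exact: (mid e).
  by apply: filterS (IH x fx pk) => y; left.
have e0 := sqlen_koch_edges_neq0 ek.
have P1 := polygon_thirds (i := 1) (x := x) ek isT.
have P2 := polygon_thirds (i := 2) (x := x) ek isT.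
have := coords_thirds 1 x e0; have := coords_thirds 2 x e0 => /= -[E1 E2] [E3 E4].
have [t0|t0] := leP (tc e x) 0; first by apply: (mid e ek); lra.
have [t1|t1] := leP (sc e x - 1 / 3) (tc e x); first by exfalso; apply/px/P1; lra.
have [t2|t2] := leP (2 / 3 - sc e x) (tc e x); first by exfalso; apply/px/P2; lra.
have : ospike e x by [].
move=> /near_ospike; apply: filterS => y /ospike_spike ey.
by right; exists e.
Qed.

(* [inner] and [outer] are disjoint open sets covering the complement of the
   curve, so a component meeting the bounded set [inner] stays in it. *)
Definition inner : set (R * R) := \bigcup_k (fill k `\` cover k).

Definition outer : set (R * R) := \bigcup_k ~` (fill k `|` cover k).

Lemma open_inner : open inner.
Proof.
rewrite openE => x [k _ [fx cx]].
have px : ~ koch_polygon R k x by move=> /koch_polygon_cover.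
apply: filterS2 (near_fill fx px) (near_notin (@closed_cover R k) cx) => y *.
by exists k.
Qed.

Lemma open_outer : open outer.
Proof.
apply: bigcup_open => k _; apply: closed_openC; apply: closedU.
- exact: closed_fill.
- exact: closed_cover.
Qed.

Lemma inner_outer : inner `&` outer = set0.
Proof.
apply/seteqP; split=> // x [[j _ [fj cj]] [k _ /not_orP[fk ck]]].
have [jk|/ltnW kj] := leqP j k; first exact/fk/(fill_subset jk).
exact/fk/(fill_stable kj).
Qed.

Lemma inner_outerU : inner `|` outer = ~` koch_curve R.
Proof.
rewrite koch_curveE; apply/seteqP; split=> x.
  by move=> [[k _ [_ ck]]|[k _ /not_orP[_ ck]]] /(_ k I).
move=> /existsNP[k /not_implyP[_ ck]].
by have [fk|fk] := pselect (fill k x); [left|right]; exists k => // -[].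
Qed.

(** The vertices of the base triangle have norm at most 1 and the caps have diameter at most 2; the
    bound 4 is crude. *)
Lemma cover0_norm x : cover 0 x -> `|x| <= 4.
Proof.
move=> [e e0 ex]; have e1 : `|e.1| <= 1 :> R.
  have w3 := @sqrt3_sqr R; have w0 := @sqrt3_gt0 R.
  move: e0; rewrite !inE => /or3P[] /eqP ->; rewrite prod_normE /= ge_max.
  - by rewrite normr0 ler01.
  - by rewrite normr1 normr0 ler01 lexx.
  - by rewrite !ger0_norm//; nra.
have := norm_le_edist2 x e.1; have := edist2_cap e0 ex (start_cap e).
have := lerB_dist x e.1; rewrite expr0; lra.
Qed.

Lemma fill_norm k x : fill k x -> `|x| <= 4.
Proof.
elim: k x => [|k IH] x; last first.
  move=> [/IH//|[e ek /spike_cap ex]].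
  by apply/cover0_norm/(cover_subset (leq0n k)); exists e.
move=> Tx; have [E1 E2 E3 E4] := coords_side x.
have := Tx 0%N isT; have := Tx 1%N isT; have := Tx 2%N isT => t2 t1 t0.
have s0 := sqlen_koch_edges (side_in (i := 0) isT).
have := sqr_edist2_coords x (0, 0) (sqlen_koch_edges_neq0 (side_in (i := 0) isT)).
have -> : sc (side 0) (0, 0) = 0 :> R by exact: (sc_start (side 0)).
have -> : tc (side 0) (0, 0) = 0 :> R by exact: (tc_start (side 0)).
rewrite s0 expr0 => d; have := norm_le_edist2 x (0, 0).
have d0 := edist2_ge0 x (0, 0); rewrite subr0.
suff : edist2 x (0, 0) <= 4 by move=> h4 /le_trans; apply.
nra.
Qed.

Lemma inner_snowflake : inner `<=` snowflake R.
Proof.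
apply: (clopen_enclosed open_inner open_outer inner_outer inner_outerU).
exists 4; split=> // M /ltW M4 x [k _ [fx _]]; exact: le_trans (fill_norm fx) M4.
Qed.

(** The open spike is in [fill k.+1] and misses the caps of the four children of [e], so it is part
    of [inner]. *)
Lemma ospike_snowflake k e : e \in koch_edges R k -> ospike e `<=` snowflake R.
Proof.
move=> ek x ex; apply: inner_snowflake; exists k.+1 => //; split.
  by right; exists e => //; exact: ospike_spike.
apply: (ocap_notin_cover ek); first exact: ospike_ocap.
move=> i i4 [h1 h2 h3]; case: ex => k1 k2 k3.
have [] := coords_thirds i x (sqlen_koch_edges_neq0 ek).
by case: i i4 h1 h2 h3 => [|[|[|[|//]]]] _ h1 h2 h3 /= E1 E2; lra.
Qed.

(** The radial ray from [x] to infinity avoids the ball of radius 4 that contains the curve. *)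
Lemma far_notin_snowflake x : 4 < `|x| -> ~ snowflake R x.
Proof.
move=> x4; have x0 : x != 0 by rewrite -normr_gt0; exact: lt_trans x4.
apply: (ray_notin_enclosed x0) => u u0 /(koch_curve_cover 0)/cover0_norm.
rewrite -[x in x + _]scale1r -scalerDl normrZ ger0_norm ?addr_ge0//.
nra.
Qed.

End Inside.

(** * Points outside the snowflake *)

Section Outside.
Context {R : realType}.
Implicit Types (e f : (R * R) * (R * R)) (x y z : R * R) (k : nat) (b : bool).

(* The symmetry of [cap e] exchanges the endpoints of [e]; [b] selects one of the
   two oblique sides [3 * tc e x = sg b e x]. *)
Definition sg b e x : R := if b then sc e x else 1 - sc e x.

(* The open equilateral triangle whose vertices are an endpoint of the middle
   third of [e] and the points cutting the side [b] of [cap e] in three. *)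
Definition notch b e : set (R * R) :=
  [set x | [/\ sg b e x < 1 / 3, 3 * tc e x < sg b e x &
              1 - 3 * sg b e x < 9 * tc e x]].

Lemma sg_line b e x y (u : R) :
  sg b e (x + u *: (y - x)) = sg b e x + u * (sg b e y - sg b e x).
Proof. by case: b; rewrite /sg sc_line//; ring. Qed.

Lemma near_sg_gt0 b e (p q r : R) z : 0 < p * sg b e z + q * tc e z + r ->
  \forall y \near z, 0 < p * sg b e y + q * tc e y + r.
Proof.
case: b => /= h; first exact: near_affine_gt0.
have /near_affine_gt0 : 0 < - p * sc e z + q * tc e z + (p + r) by lra.
by apply: filterS => y; lra.
Qed.

Lemma notch_ocap b e : notch b e `<=` ocap e.
Proof. by case: b => x [/= h1 h2 h3]; split; lra. Qed.

Lemma notch_notin_cover k b e x : e \in koch_edges R k -> notch b e x -> ~ cover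
  k.+1 x.
Proof.
move=> ek ex; apply: (ocap_notin_cover ek); first exact: notch_ocap ex.
move=> i i4 [h1 h2 h3]; case: ex => k1 k2 k3.
have [] := coords_thirds i x (sqlen_koch_edges_neq0 ek).
by case: b k1 k2 k3 => /= k1 k2 k3;
  case: i i4 h1 h2 h3 => [|[|[|[|//]]]] _ h1 h2 h3 /= E1 E2; lra.
Qed.

(* Just beyond an oblique side of a cap of generation [k] one is outside the
   snowflake and outside all the caps. *)
Definition outer_sides k := forall e b z, e \in koch_edges R k ->
  3 * tc e z = sg b e z -> 0 < sg b e z < 1 / 2 ->
  \forall y \near z, sg b e y < 3 * tc e y -> ~ snowflake R y /\ ~ cover k y.

(* A cap of generation [k.+1] through [z], if not inside [cap e], has interior
   points near [z]; they are neither in [cap e] nor beyond its side. *)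
Lemma side_midpoint_notin_cover k b e z : outer_sides k -> e \in koch_edges R k ->
  sg b e z = 1 / 4 -> tc e z = 1 / 12 -> ~ cover k.+1 z.
Proof.
move=> Ok ek sz tz [_ /koch_edgesSP[f fk [i i4 ->]] fz].
have e0 := sqlen_koch_edges_neq0 ek; have f0 := sqlen_koch_edges_neq0 fk.
have [ef|nef] := eqVneq e f.
  rewrite -ef in fz; case: fz => h1 h2 h3; have [] := coords_thirds i z e0.
  by case: b sz => /= sz;
    case: i i4 h1 h2 h3 => [|[|[|[|//]]]] _ h1 h2 h3 /= E1 E2; lra.
have [c fc] := ocap_ne f0.
have n1 : \forall y \near z, sg b e y < 3 * tc e y -> ~ snowflake R y /\ ~ cover
  k y.
  by apply: Ok; rewrite // sz; lra.
(* The point [z] is strictly on the inner side of the two other sides of [cap e], and this persists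
   nearby. *)
have /near_sg_gt0 n2 : 0 < 0 * sg b e z + 1 * tc e z + 0 by lra.
have /near_sg_gt0 n3 : 0 < -1 * sg b e z + -3 * tc e z + 1 by lra.
pose Q : set (R * R) := [set y | [/\
  sg b e y < 3 * tc e y -> ~ snowflake R y /\ ~ cover k y,
  0 < 0 * sg b e y + 1 * tc e y + 0 & 0 < -1 * sg b e y + -3 * tc e y + 1]].
have nQ : \forall y \near z, Q y by apply: filterS3 n1 n2 n3 => y; split.
have [u [u0 u1 [m1 m2 m3]]] := near_line c nQ.
have fy : ocap f (z + u *: (c - z)).
  by apply: line_ocap; rewrite ?u0//; exact: cap_thirds fz.
(* A nearby point of [ocap f] lies either in [cap e], against the disjointness of caps, or beyond
   the side [b], against [outer_sides]. *)
have [le_side|/m1[_]] := leP (3 * tc e (z + u *: (c - z)))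
                             (sg b e (z + u *: (c - z))); last first.
  by apply; exists f => //; exact: ocapW.
apply: (disjoint_ocap_cap e0 _ fy) => [y fy' ey|].
  by move/eqP: nef; apply; exact: (ocap_koch_edges_inj ek fk ey fy').
by case: b le_side m2 m3 {Ok n1 m1 n2 n3 sz Q nQ} => /= le_side m2 m3; split; lra.
Qed.

(* Leave the notch through the midpoint [z] of its side on the boundary of
   [cap e]. *)
Lemma notch_notin_snowflake k b e x : outer_sides k -> e \in koch_edges R k ->
  notch b e x -> ~ snowflake R x.
Proof.
move=> Ok ek ex; have e0 := sqlen_koch_edges_neq0 ek.
pose z := pt e (if b then 1 / 4 else 3 / 4) (1 / 12).
have sz : sg b e z = 1 / 4 by rewrite /sg sc_pt//; case: (b); lra.
have tz : tc e z = 1 / 12 by rewrite tc_pt.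
have nz : ~ koch_curve R z.
  by move=> /(koch_curve_cover k.+1); exact: side_midpoint_notin_cover sz tz.
have /near_segment n1 : \forall y \near z, sg b e y < 3 * tc e y ->
    ~ snowflake R y /\ ~ cover k y by apply: Ok; rewrite // ?sz; lra.
(* Moving from [z] towards the reflection of [x] through [z] prolongs the segment from [x] to [z]
   slightly beyond the side. *)
have [u [u0 u1 seg]] := near_line (z + (z - x)) n1.
rewrite addrAC subrr add0r in seg; set y := z + _ in seg.
have beyond (v : R) : 0 < v -> sg b e (z + v *: (y - z)) < 3 * tc e (z + v *: (y
  - z)).
  have -> : y = z + (- u) *: (x - z) by rewrite scaleNr -scalerN opprB.
  case: ex => h1 h2 h3 v0; rewrite sg_line tc_line !sg_line !tc_line sz tz.
  have := mulr_gt0 v0 u0.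
  have := mulr_gt0 (mulr_gt0 v0 u0) (_ : 0 < sg b e x - 3 * tc e x).
  rewrite subr_gt0 => /(_ h2); nra.
(* Neither half of the path meets the curve: before [z] it stays in the notch, after [z] it is
   beyond the side and off [cover k]. *)
have [xz yz] : (snowflake R x <-> snowflake R z) /\ (snowflake R z <-> snowflake
  R y).
  split; apply: enclosed_segment => p [v].
    rewrite /= in_itv /= => /andP[v0]; rewrite le_eqVlt => /predU1P[->|v1] <-.
      by rewrite scale1r addrC subrK.
    move=> /(koch_curve_cover k.+1); apply: (notch_notin_cover (b := b) ek).
    by case: ex => h1 h2 h3; rewrite /notch /= sg_line tc_line sz tz; split; nra.
  rewrite /= in_itv /= => /andP[]; rewrite le_eqVlt => /predU1P[<-|v0] v1 E.
    by rewrite -E scale0r addr0.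
  have : segment z y p by exists v => //; rewrite /= in_itv /= (ltW v0).
  move=> /seg; rewrite -E => /(_ (beyond v v0))[_ +] /(koch_curve_cover k).
  exact.
rewrite xz yz; have := beyond 1 ltr01; rewrite scale1r addrC subrK.
by move=> /(seg _ (segment_end z y))[].
Qed.

Lemma beyond_side_notin_cover0 b i x : (i < 3)%N ->
  sg b (side i) x < 3 * tc (side i) x -> ~ cover 0 x.
Proof.
move=> i3 h [_ /sideP[j j3 ->] [h1 h2 h3]]; have [E1 E2 E3 E4] := coords_side x.
by case: b h => /= h; case: i i3 h => [|[|[|//]]] _ h;
   case: j j3 h1 h2 h3 => [|[|[|//]]] _ h1 h2 h3; lra.
Qed.

(** The ray in the direction of the outward normal of the side stays beyond the same oblique side,
    hence off [cover 0]. *)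
Lemma beyond_side_notin_snowflake b i x : (i < 3)%N ->
  sg b (side i) x < 3 * tc (side i) x -> ~ snowflake R x.
Proof.
move=> i3 bx; have e0 := sqlen_koch_edges_neq0 (side_in (R := R) i3).
pose y := pt (side i) (sc (side i) x) (tc (side i) x + 1).
have sy : sg b (side i) y = sg b (side i) x by rewrite /sg sc_pt.
have ty : tc (side i) y = tc (side i) x + 1 by rewrite tc_pt.
apply: (@ray_notin_enclosed _ _ _ (y - x)).
  by rewrite subr_eq0; apply/eqP => yx; move: ty; rewrite yx; lra.
move=> u u0 /(koch_curve_cover 0); apply: (@beyond_side_notin_cover0 b i _ i3).
by rewrite sg_line tc_line sy ty; nra.
Qed.

(** Of the eight oblique sides of the children's caps, four lie on the oblique sides of the parent
    cap and inherit the property; the other four border a notch, which is outside the snowflake by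
    the induction hypothesis. *)
Lemma outer_sidesP k : outer_sides k.
Proof.
elim: k => [|k IH] e b z.
  move=> /sideP[i i3 ->] _ _; apply: (@filterE _ (nbhs z)) => y by_.
  by split; [exact: beyond_side_notin_snowflake by_ | exact:
    beyond_side_notin_cover0 by_].
move=> /koch_edgesSP[f fk [i i4 ->{e}]] t0 s0; have f0 := sqlen_koch_edges_neq0 fk.
have C y := coords_thirds i y f0.
have inherit b' : 3 * tc f z = sg b' f z -> 0 < sg b' f z < 1 / 2 ->
    (forall y, sg b (thirds f i) y < 3 * tc (thirds f i) y -> sg b' f y < 3 * tc
      f y) ->
    \forall y \near z, sg b (thirds f i) y < 3 * tc (thirds f i) y ->
      ~ snowflake R y /\ ~ cover k.+1 y.
  move=> tf sf H; apply: filterS (IH f b' z fk tf sf) => y Hy /H/Hy[? ck];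
    split=> //.
  by move=> /(cover_subset (leqnSn k)).
have new b' (p q r p' q' r' : R) : 0 < p * sg b' f z + q * tc f z + r ->
    0 < p' * sg b' f z + q' * tc f z + r' ->
    (forall y, 0 < p * sg b' f y + q * tc f y + r ->
       0 < p' * sg b' f y + q' * tc f y + r' ->
       sg b (thirds f i) y < 3 * tc (thirds f i) y -> notch b' f y) ->
    \forall y \near z, sg b (thirds f i) y < 3 * tc (thirds f i) y ->
      ~ snowflake R y /\ ~ cover k.+1 y.
  move=> /near_sg_gt0 n1 /near_sg_gt0 n2 H.
  apply: filterS2 n1 n2 => y h1 h2 h3; have fy := H y h1 h2 h3.
  by split; [exact: notch_notin_snowflake fk fy | exact: notch_notin_cover fk fy].
case: i b i4 t0 s0 C inherit new => [|[|[|[|//]]]] [] _ /= t0 s0 C inherit new.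
- by apply: (inherit true) => [||y h]; [have := C z|have := C z|have := C y];
    rewrite /= => -[E1 E2]; lra.
- by apply: (new true (-1) 0 (1 / 3) 1 (-3) 0) => [||y h1 h2 h3];
    [have := C z|have := C z|move: h1 h2 h3; have := C y]; rewrite /= => -[E1 E2] *;
    try split; rewrite /=; lra.
- by apply: (new true 1 (-3) 0 3 9 (-1)) => [||y h1 h2 h3];
    [have := C z|have := C z|move: h1 h2 h3; have := C y]; rewrite /= => -[E1 E2] *;
    try split; rewrite /=; lra.
- by apply: (inherit true) => [||y h]; [have := C z|have := C z|have := C y];
    rewrite /= => -[E1 E2]; lra.
- by apply: (inherit false) => [||y h]; [have := C z|have := C z|have := C y];
    rewrite /= => -[E1 E2]; lra.
- by apply: (new false 1 (-3) 0 3 9 (-1)) => [||y h1 h2 h3];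
    [have := C z|have := C z|move: h1 h2 h3; have := C y]; rewrite /= => -[E1 E2] *;
    try split; rewrite /=; lra.
- by apply: (new false (-1) 0 (1 / 3) 1 (-3) 0) => [||y h1 h2 h3];
    [have := C z|have := C z|move: h1 h2 h3; have := C y]; rewrite /= => -[E1 E2] *;
    try split; rewrite /=; lra.
- by apply: (inherit false) => [||y h]; [have := C z|have := C z|have := C y];
    rewrite /= => -[E1 E2]; lra.
Qed.

End Outside.

(** * Areas *)

Section MonotoneIntegral.
Local Open Scope ereal_scope.
Context d (T : measurableType d) (R : realType).
Variable mu : {measure set T -> \bar R}.

(* Without any measurability assumption, since the integral of a nonnegative
   function is a supremum over the simple functions below it. *)
Lemma ge0_integral_mono (D E : set T) (f g : T -> \bar R) :
  (forall x, D x -> 0 <= f x) -> (forall x, E x -> 0 <= g x) ->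
  (forall x, (f \_ D) x <= (g \_ E) x) ->
  \int[mu]_(x in D) f x <= \int[mu]_(x in E) g x.
Proof.
move=> f0 g0 fg; rewrite !ge0_integralE//; apply: ereal_sup_le => _ [h hf <-].
by exists h => // x; apply: le_trans (fg x).
Qed.

End MonotoneIntegral.

Lemma bigsetUP (T : Type) (I : choiceType) (s : seq I) (F : I -> set T) x :
  (\big[setU/set0]_(i <- s) F i) x <-> exists2 i, i \in s & F i x.
Proof. by rewrite -bigcup_seq. Qed.

Section Boxes.
Context {R : realType}.
Implicit Types (x c : R * R) (r : R).
Local Notation mu := (leb2 R).

(** The product measure of an arbitrary set is the integral of the outer measures of its sections,
    and both operations are monotone. *)
Lemma leb2_mono (A B : set (R * R)) : A `<=` B -> (mu A <= mu B)%E.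
Proof.
move=> AB; apply: ge0_integral_mono => // x.
rewrite !patch_setT; apply: le_outer_measure => y; rewrite /xsection /= !inE.
exact: AB.
Qed.

Definition box c r : set (R * R) :=
  `[c.1 - r, c.1 + r]%classic `*` `[c.2 - r, c.2 + r]%classic.

Lemma boxP c r x : box c r x <-> `|x - c| <= r.
Proof.
rewrite /box /= !in_itv /= prod_normE /= ge_max !ler_distl.
by split=> [[-> ->]|/andP[-> ->]].
Qed.

Lemma measurable_box c r : measurable (box c r).
Proof. by apply: measurableX; exact: measurable_itv. Qed.

Lemma leb2_box c r : 0 <= r -> mu (box c r) = (4 * r ^+ 2)%:E.
Proof.
move=> r0; rewrite /box product_measure1E; try exact: measurable_itv.
have E (a : R) : lebesgue_measure `[a - r, a + r]%classic = (2 * r)%:E.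
  rewrite lebesgue_measure_itv /= lte_fin; case: ltP => h.
    by rewrite -EFinB; congr (_%:E); ring.
  by congr (_%:E); lra.
transitivity ((2 * r)%:E * (2 * r)%:E)%E; first by congr (_ * _)%E; exact: E.
by rewrite -EFinM; congr (_%:E); ring.
Qed.

Lemma measurable_boxes (I : Type) (s : seq I) (c : I -> R * R) r :
  measurable (\big[setU/set0]_(i <- s) box (c i) r).
Proof. by apply: bigsetU_measurable => i _; exact: measurable_box. Qed.

Lemma leb2_boxes_le (I : Type) (s : seq I) (c : I -> R * R) r : 0 <= r ->
  (mu (\big[setU/set0]_(i <- s) box (c i) r) <= ((size s)%:R * (4 * r ^+ 2))%:E)%E.
Proof.
move=> r0; elim: s => [|i s IH]; first by rewrite big_nil measure0 mul0r.
rewrite big_cons; apply: le_trans (measureU2 _ _ _) _.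
- exact: measurable_box.
- exact: measurable_boxes.
apply: le_trans (leeD (lexx _) IH) _.
by rewrite [X in (X + _)%E]leb2_box// -EFinD lee_fin /= -natr1; lra.
Qed.

Lemma leb2_boxes (I : choiceType) (s : seq I) (c : I -> R * R) r : 0 <= r -> uniq
  s ->
  (forall i j x, i \in s -> j \in s -> box (c i) r x -> box (c j) r x -> i = j) ->
  mu (\big[setU/set0]_(i <- s) box (c i) r) = ((size s)%:R * (4 * r ^+ 2))%:E.
Proof.
move=> r0; elim: s => [|i s IH] us inj; first by rewrite big_nil measure0 mul0r.
move: us => /= /andP[ni us].
rewrite big_cons.
transitivity (mu (box (c i) r) + mu (\big[setU/set0]_(j <- s) box (c j) r))%E.
  apply: measureU; [exact: measurable_box | exact: measurable_boxes |].
  apply/seteqP; split=> // x [ix /bigsetUP[j js jx]].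
  have ij : i = j by apply: inj ix jx; rewrite ?mem_head// in_cons js orbT.
  by rewrite ij js in ni.
rewrite IH//; last first.
  by move=> j k x js ks; apply: inj; rewrite in_cons ?js ?ks orbT.
by rewrite leb2_box// -EFinD; congr (_%:E); rewrite /= -natr1; ring.
Qed.

End Boxes.

(** * Area of the neighbourhoods of the boundary *)

Section Content.
Context {R : realType}.
Implicit Types (e f : (R * R) * (R * R)) (x y z c : R * R) (k : nat) (r : R).
Local Notation mu := (leb2 R).
Local Notation len k := (3^-1 ^+ k : R).

Lemma len_gt0 k : 0 < len k.
Proof. by rewrite exprn_gt0// invr_gt0. Qed.

Definition spike_center e : R * R := pt e (1 / 2) (1 / 18).

(** The centroid of [notch true e], just as [spike_center e] is that of the spike. *)
Definition notch_center e : R * R := pt e (5 / 18) (1 / 18).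

(** The box has Euclidean radius at most [len k / 100], and the coordinates are in units of the edge
    length [len k]. The tolerance 1/100 keeps boxes about the two centroids inside the spike and the
    notch. *)
Lemma box_coords k e c x : e \in koch_edges R k -> box c (len k / 200) x ->
  `|sc e x - sc e c| <= 1 / 100 /\ `|tc e x - tc e c| <= 1 / 100.
Proof.
move=> ek /boxP xc; have e0 := sqlen_koch_edges_neq0 ek.
have l0 := len_gt0 k.
have h : (sc e x - sc e c) ^+ 2 + 3 * (tc e x - tc e c) ^+ 2 <= (1 / 100) ^+ 2.
  rewrite -(ler_pM2l (exprn_gt0 2 l0)) -{1}(sqlen_koch_edgesE ek)
    -sqr_edist2_coords//.
  have := edist2_le_norm x c; have := edist2_ge0 x c.
  move: (edist2 x c) => d d0 dx; have {}dx : d <= len k / 100 by lra.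
  by rewrite -exprMn mul1r ler_sqr ?nnegrE//; lra.
have s2 := sqr_ge0 (sc e x - sc e c); have t2 := sqr_ge0 (tc e x - tc e c).
by split; rewrite -ler_sqr ?nnegrE// real_normK ?num_real//; lra.
Qed.

Lemma box_spike k e x : e \in koch_edges R k ->
  box (spike_center e) (len k / 200) x -> ospike e x.
Proof.
move=> ek /(box_coords ek); have e0 := sqlen_koch_edges_neq0 ek.
by rewrite sc_pt// tc_pt// !ler_norml => -[/andP[? ?] /andP[? ?]]; split; lra.
Qed.

Lemma box_notch k e x : e \in koch_edges R k ->
  box (notch_center e) (len k / 200) x -> notch true e x.
Proof.
move=> ek /(box_coords ek); have e0 := sqlen_koch_edges_neq0 ek.
by rewrite sc_pt// tc_pt// !ler_norml => -[/andP[? ?] /andP[? ?]]; split;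
  rewrite /sg; lra.
Qed.

Lemma box_spike_snowflake k e x : e \in koch_edges R k ->
  box (spike_center e) (len k / 200) x -> snowflake R x.
Proof. by move=> ek /(box_spike ek); exact: ospike_snowflake ek _. Qed.

Lemma box_notch_snowflake k e x : e \in koch_edges R k ->
  box (notch_center e) (len k / 200) x -> ~ snowflake R x.
Proof. by move=> ek /(box_notch ek); apply: notch_notin_snowflake ek;
  exact: outer_sidesP. Qed.

Lemma edist2_spike_notch k e x y : e \in koch_edges R k ->
  box (spike_center e) (len k / 200) x -> box (notch_center e) (len k / 200) y ->
  edist2 x y <= 2 * len k.
Proof.
move=> ek /(box_spike ek)/ospike_ocap/ocapW ex /(box_notch ek)/notch_ocap/ocapW.
exact: edist2_cap.
Qed.

Definition spike_boxes k : set (R * R) :=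
  \big[setU/set0]_(e <- koch_edges R k) box (spike_center e) (len k / 200).

(** The [3 * 4 ^ k] boxes lie in disjoint open caps, and each is a square of side [len k / 100]. *)
Lemma leb2_spike_boxes k : mu (spike_boxes k) = (3 / 10000 * (4 / 9) ^+ k)%:E.
Proof.
rewrite /spike_boxes leb2_boxes ?uniq_koch_edges ?divr_ge0 ?(ltW (len_gt0 k))//.
  rewrite size_koch_edges natrM natrX; congr (_%:E).
  have -> : (4 / 9 : R) ^+ k = 4 ^+ k * (len k ^+ 2).
    by rewrite exprMn exprAC; congr (_ * _ ^+ k); field.
  by move: (len k) => l; rewrite expr_div_n; field.
move=> e f x ek fk /(box_spike ek)/ospike_ocap ex /(box_spike fk)/ospike_ocap fx.
exact: (ocap_koch_edges_inj ek fk ex fx).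
Qed.

Lemma frontier_snowflake_cover k : frontier (snowflake R) `<=` cover k.
Proof.
by move=> x /(frontier_enclosed (@closed_koch_curve R)); exact: koch_curve_cover.
Qed.

Lemma dist_to_le (G : set (R * R)) x y : G y -> (dist_to G x <= (edist2 x y)%:E)%E.
Proof. by move=> Gy; apply: ereal_inf_lbound; exists y. Qed.

Lemma frontier_between k x y : snowflake R x -> ~ snowflake R y ->
  exists2 z, cover k z & `|x - z| <= `|x - y| /\ frontier (snowflake R) z.
Proof.
move=> Sx Sy; have [z /segment_norm xz fz] := segment_frontier Sx Sy.
by exists z; [exact: frontier_snowflake_cover | split].
Qed.

(** A point of a spike box is within [2 * len k] of a notch center outside the snowflake, so a
    boundary point lies within that sup distance; passing to the Euclidean distance costs another
    factor 2. *)
Lemma closed_nbhd_ge k r : 4 * len k <= r ->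
  ((3 / 10000 * (4 / 9) ^+ k)%:E <= mu (closed_nbhd (frontier (snowflake R)) r))%E.
Proof.
move=> lr; rewrite -leb2_spike_boxes; apply: leb2_mono => x /bigsetUP[e ek ex].
have ey : box (notch_center e) (len k / 200) (notch_center e).
  by apply/boxP; rewrite subrr normr0 divr_ge0// ltW// len_gt0.
have [z _ [xz fz]] :=
  frontier_between 0 (box_spike_snowflake ek ex) (box_notch_snowflake ek ey).
apply: le_trans (dist_to_le _ fz) _; rewrite lee_fin.
have := edist2_le_norm x z; have := norm_le_edist2 x (notch_center e).
have := edist2_spike_notch ek ex ey; lra.
Qed.

Definition cover_boxes k : set (R * R) :=
  \big[setU/set0]_(e <- koch_edges R k) box e.1 (4 * len k).

(** There are [3 * 4 ^ k] squares of area [64 * len k ^+ 2], and 192 is 3 times 64. *)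
Lemma leb2_cover_boxes k : (mu (cover_boxes k) <= (192 * (4 / 9) ^+ k)%:E)%E.
Proof.
apply: le_trans (leb2_boxes_le _ _ _) _;
  first by rewrite mulr_ge0 ?(ltW (len_gt0 k)).
rewrite size_koch_edges natrM natrX lee_fin.
have -> : (4 / 9 : R) ^+ k = 4 ^+ k * (len k ^+ 2).
  by rewrite exprMn exprAC; congr (_ * _ ^+ k); field.
by move: (len k) => l; rewrite exprMn; lra.
Qed.

Lemma near_cover_boxes k x z : cover k z -> `|x - z| <= 2 * len k -> cover_boxes
  k x.
Proof.
move=> [e ek ez] xz; apply/bigsetUP; exists e => //; apply/boxP.
have := ler_distD z x e.1; have := norm_le_edist2 z e.1.
have := edist2_cap ek ez (start_cap e); lra.
Qed.

Lemma closed_nbhd_le k r : 0 < r <= len k ->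
  (mu (closed_nbhd (frontier (snowflake R)) r) <= (192 * (4 / 9) ^+ k)%:E)%E.
Proof.
move=> /andP[r0 rl]; apply: le_trans (leb2_cover_boxes k); apply: leb2_mono => x xr.
(* A strict bound on the infimum yields an actual boundary point; doubling [r] makes the bound
   strict. *)
have : (dist_to (frontier (snowflake R)) x < (2 * r)%:E)%E.
  by apply: le_lt_trans xr _; rewrite lte_fin; lra.
move=> /ereal_inf_lt[_ [z fz <-]]; rewrite lte_fin => xz.
apply: near_cover_boxes (frontier_snowflake_cover k fz) _.
have := norm_le_edist2 x z; lra.
Qed.

End Content.

(** * Minkowski dimension *)

Section Dimension.
Context {R : realType}.
Implicit Types (k : nat) (r s : R).
Local Notation mu := (leb2 R).
Local Notation len k := (3^-1 ^+ k : R).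
Local Notation d := (ln 4 / ln 3 : R).

Lemma ln3_gt0 : 0 < ln 3 :> R.
Proof. by apply: ln_gt0; rewrite ltr1n. Qed.

Lemma koch_dim_gt1 : 1 < d.
Proof.
by rewrite ltr_pdivlMr ?ln3_gt0// mul1r ltr_ln ?posrE// ltr_nat.
Qed.

Lemma koch_dim_lt2 : d < 2.
Proof.
rewrite ltr_pdivrMr ?ln3_gt0// mulr_natl -lnXn// ltr_ln ?posrE ?exprn_gt0//.
by rewrite -natrX ltr_nat.
Qed.

Lemma powR3_dim : 3 `^ d = 4 :> R.
Proof.
by rewrite /powR pnatr_eq0 /= divfK ?gt_eqF ?ln3_gt0// lnK ?posrE.
Qed.

Lemma powRXn (a : R) k s : 0 <= a -> (a ^+ k) `^ s = (a `^ s) ^+ k.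
Proof.
by move=> a0; rewrite -(powR_mulrn k a0) -(powR_mulrn k (powR_ge0 a s)) powRAC.
Qed.

Lemma powR_len k s : len k `^ s = ((3 `^ s)^-1) ^+ k.
Proof.
rewrite powRXn ?invr_ge0//; congr (_ ^+ _).
by rewrite -[3^-1]powR_inv1// powRAC powR_inv1 ?powR_ge0.
Qed.

Lemma powR_codim : 3 `^ (2 - d) = 9 / 4 :> R.
Proof.
rewrite powRB ?pnatr_eq0 ?implybT// powR3_dim.
by rewrite (powR_mulrn 2)// -natrX.
Qed.

Lemma len_codim k : (4 / 9) ^+ k = len k `^ (2 - d).
Proof. by rewrite powR_len powR_codim invf_div. Qed.

Lemma len_cvg0 (r : R) : 0 < r -> exists k, len k < r.
Proof.
move=> r0; have : `|3^-1 : R| < 1.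
  by rewrite gtr0_norm ?invr_gt0// invf_lt1// ltr1n.
by move=> /cvg_expr/cvgr_lt/(_ _ r0)[k _ /(_ k (leqnn k))]; exists k.
Qed.

Lemma len_scale (r : R) : 0 < r <= 1 -> exists k, len k.+1 < r <= len k.
Proof.
move=> /andP[r0 r1]; have [k kr] := len_cvg0 r0.
have ex : exists k, len k < r by exists k.
case: (ex_minnP ex) => -[|m] mr mmin; first by rewrite expr0 ltNge r1 in mr.
exists m; rewrite mr leNgt; apply/negP => /mmin; by rewrite ltnn.
Qed.

Lemma closed_nbhd_bounds : exists c C : R, [/\ 0 < c, 0 < C &
  forall r, 0 < r <= 1 ->
  ((c * r `^ (2 - d))%:E <= mu (closed_nbhd (frontier (snowflake R)) r))%E /\
  (mu (closed_nbhd (frontier (snowflake R)) r) <= (C * r `^ (2 - d))%:E)%E].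
Proof.
(* If [len k.+1 < r <= len k], then [4 * len (3 + k) <= r], whence the shift by three generations
   below. Above, [len k <= 3 * r] costs the factor [3^(2 - d) = 9 / 4], and 432 is 192 times 9/4. *)
exists (3 / 10000 * (4 / 9) ^+ 3), 432; split; [|lra|move=> r r01].
  by apply: mulr_gt0; [lra | apply: exprn_gt0; lra].
have [k /andP[kr rk]] := len_scale r01; have /andP[r0 r1] := r01.
have dd : 0 <= 2 - d by have := koch_dim_lt2; lra.
split.
- apply: le_trans (closed_nbhd_ge (k := (3 + k)%N) _); last first.
    by rewrite exprD; move: kr; rewrite exprS; lra.
  rewrite lee_fin exprD mulrA ler_pM2l; last by apply: mulr_gt0;
    [lra | apply: exprn_gt0; lra].
  by rewrite len_codim ge0_ler_powR ?nnegrE ?(ltW r0) ?(ltW (len_gt0 k)).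
- apply: le_trans (closed_nbhd_le (k := k) _) _; first by rewrite r0.
  have -> : 432 * r `^ (2 - d) = 192 * (3 * r) `^ (2 - d).
    by rewrite powRM ?(ltW r0)// powR_codim; field.
  rewrite lee_fin ler_pM2l// len_codim ge0_ler_powR ?nnegrE ?(ltW (len_gt0 k))//.
    by rewrite mulr_ge0 ?(ltW r0).
  by move: kr; rewrite exprS; lra.
Qed.

Lemma near_right0 : \forall r \near (0 : R)^'+, 0 < r <= 1.
Proof.
near=> r; apply/andP; split; first by near: r; exact: nbhs_right_gt.
by near: r; apply: nbhs_right_le.
Unshelve. all: by end_near. Qed.

(** The normalised area is comparable to [t^(r - d)], so the sign of [r - d] decides whether it
    vanishes, stays between positive constants or blows up as [t] tends to 0. *)
Lemma content_bounds : exists c C : R, [/\ 0 < c, 0 < C &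
  forall r t, 0 < t <= 1 ->
  ((c * t `^ (r - d))%:E <=
     mu (closed_nbhd (frontier (snowflake R)) t) * (t `^ (r - 2))%:E)%E /\
  (mu (closed_nbhd (frontier (snowflake R)) t) * (t `^ (r - 2))%:E <=
     (C * t `^ (r - d))%:E)%E].
Proof.
have [c [C [c0 C0 B]]] := closed_nbhd_bounds.
exists c, C; split=> // r t t01; have [B1 B2] := B t t01.
have /andP[t0 _] := t01.
have -> : t `^ (r - d) = t `^ (2 - d) * t `^ (r - 2).
  by rewrite -powRD; [congr powR; ring | rewrite (gt_eqF t0) implybT].
by rewrite !mulrA !EFinM; split; rewrite lee_wpmul2r// lee_fin powR_ge0.
Qed.

Lemma content_ge0 r t :
  (0 <= mu (closed_nbhd (frontier (snowflake R)) t) * (t `^ (r - 2))%:E)%E.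
Proof. by rewrite mule_ge0// lee_fin powR_ge0. Qed.

Lemma lower_content_gt r : d < r -> lower_content r (frontier (snowflake R)) = 0%E.
Proof.
move=> dr; have [c [C [c0 C0 B]]] := content_bounds.
rewrite /lower_content limf_einfE; apply/eqP; rewrite eq_le; apply/andP; split.
  apply: ge_ereal_sup => _ [V V0 <-]; apply/lee_addgt0Pr => e e0; rewrite add0e.
  have rd : 0 < r - d by rewrite subr_gt0.
  have eC : 0 < e / C by rewrite divr_gt0.
  have /cvgr_lt/(_ _ eC) n1 := powR_cvg0 rd.
  have : \forall t \near (0 : R)^'+, [/\ 0 < t <= 1, t `^ (r - d) < e / C & V t].
    by apply: filterS3 near_right0 n1 V0 => t.
  move=> /filter_ex[t [t01 te Vt]].
  have [_ ht] := B r t t01; apply: le_trans (le_trans _ ht) _.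
    by apply: ereal_inf_lbound; exists t.
  by rewrite lee_fin mulrC -ler_pdivlMr//; exact: ltW.
apply: le_ereal_sup_tmp; exists (ereal_inf ((fun t : R =>
    mu (closed_nbhd (frontier (snowflake R)) t) * (t `^ (r - 2))%:E)%E @` setT)).
  by exists setT => //; exact: filterT.
by apply: le_ereal_inf_tmp => _ [t _ <-]; exact: content_ge0.
Qed.

Lemma lower_content_le r : r <= d -> lower_content r (frontier (snowflake R)) <>
  0%E.
Proof.
move=> rd L0; have [c [C [c0 C0 B]]] := content_bounds.
suff : (c%:E <= lower_content r (frontier (snowflake R)))%E.
  by rewrite L0 lee_fin leNgt c0.
rewrite /lower_content limf_einfE; apply: le_ereal_sup_tmp; eexists.
  by exists [set t | 0 < t <= 1] => //; exact: near_right0.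
apply: le_ereal_inf_tmp => _ [t t01 <-]; have [h _] := B r t t01.
apply: le_trans h; rewrite lee_fin ler_peMr ?(ltW c0)//.
by rewrite -[leLHS](powRr0 t); apply: (ger_powR t01); rewrite subr_le0.
Qed.

Lemma upper_content_lt r : r < d -> upper_content r (frontier (snowflake R)) =
  +oo%E.
Proof.
move=> rd; have [c [C [c0 C0 B]]] := content_bounds.
rewrite /upper_content limf_esupE; apply/eqyP => N N0.
apply: le_ereal_inf_tmp => _ [V V0 <-].
have dr : 0 < d - r by rewrite subr_gt0.
have cN : 0 < c / N by rewrite divr_gt0.
have /cvgr_lt/(_ _ cN) n1 := powR_cvg0 dr.
have : \forall t \near (0 : R)^'+, [/\ 0 < t <= 1, t `^ (d - r) < c / N & V t].
  by apply: filterS3 near_right0 n1 V0 => t.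
move=> /filter_ex[t [t01 te Vt]].
apply: le_ereal_sup_tmp; eexists; first by exists t.
have [h _] := B r t t01; apply: le_trans h; rewrite lee_fin.
have /andP[t0 _] := t01.
have p0 := powR_gt0 (d - r) t0.
rewrite -opprB powRN ler_pdivlMr//.
by move: te; rewrite ltr_pdivlMr// mulrC => /ltW.
Qed.

Lemma upper_content_ge r : d <= r -> upper_content r (frontier (snowflake R)) <>
  +oo%E.
Proof.
move=> dr L; have [c [C [c0 C0 B]]] := content_bounds.
suff : (upper_content r (frontier (snowflake R)) <= C%:E)%E by rewrite L leye_eq.
rewrite /upper_content limf_esupE.
apply: (@le_trans _ _ (ereal_sup ((fun t : R =>
    mu (closed_nbhd (frontier (snowflake R)) t) * (t `^ (r - 2))%:E)%E
      @` [set t | 0 < t <= 1]))).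
  by apply: ereal_inf_lbound; exists [set t | 0 < t <= 1] => //; exact: near_right0.
apply: ge_ereal_sup => _ [t t01 <-]; have [_ h] := B r t t01.
apply: le_trans h _; rewrite lee_fin ler_piMr ?(ltW C0)//.
by rewrite -[leRHS](powRr0 t); apply: (ger_powR t01); rewrite subr_ge0.
Qed.

Lemma snowflake_minkowski_dim : has_minkowski_dim (frontier (snowflake R)) d%:E.
Proof.
have d1 := koch_dim_gt1; have d2 := koch_dim_lt2; split.
- apply/eqP; rewrite eq_le; apply/andP; split.
    (* Exponents are restricted to at most 2; if [d + e] exceeds 2, the exponent 2 serves, since
       [d < 2]. *)
    apply/lee_addgt0Pr => e e0; have [h|h] := leP (d + e) 2.
      apply: ereal_inf_lbound; exists (d + e) => //; split; first lra.
      by apply: lower_content_gt; lra.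
    apply: (@le_trans _ _ 2%:E); last by rewrite lee_fin ltW.
    by apply: ereal_inf_lbound; exists 2 => //; split;
      [lra | exact: lower_content_gt].
  apply: le_ereal_inf_tmp => _ [r [r02 r0] <-]; rewrite lee_fin leNgt.
  by apply/negP => /ltW/lower_content_le.
- apply/eqP; rewrite eq_le; apply/andP; split.
    apply: ge_ereal_sup => _ [r [r02 r0] <-]; rewrite lee_fin leNgt.
    by apply/negP => /ltW/upper_content_ge.
  apply/lee_subgt0Pr => e e0.
  (* The exponent must be nonnegative, hence the truncation at 0, which is still below [d]. *)
  apply: (@le_trans _ _ (Num.max 0 (d - e))%:E);
    first by rewrite lee_fin le_max lexx orbT.
  apply: ereal_sup_ubound; exists (Num.max 0 (d - e)) => //; split.
    by rewrite le_max lexx /= ge_max; lra.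
  by apply: upper_content_lt; rewrite gt_max; lra.
Qed.

End Dimension.

(** * Fractional perimeter *)

Section Kernels.
Context {R : realType}.
Implicit Types (x y : R * R) (n : nat).
Local Notation mu := (leb2 R).
Local Open Scope ereal_scope.

Variables (A r : nat -> R) (X : nat -> set (R * R)).
Hypotheses (A0 : forall n, (0 <= A n)%R) (r0 : forall n, (0 <= r n)%R).
Hypothesis mX : forall n, measurable (X n).

(** One scale of a majorant of the singular kernel: constant where [x] is in [X n] and [y] is within
    [r n] of [x]. Both iterated integrals of a sum of such terms are explicit. *)
Definition scale_kernel n x y : \bar R :=
  (A n * \1_(X n) x)%:E * (\1_(box x (r n)) y)%:E.

Definition scale_weight n x : \bar R := (A n * (4 * r n ^+ 2))%:E * (\1_(X n) x)%:E.

Lemma indic_ge0 (B : set (R * R)) x : 0 <= (\1_B x)%:E :> \bar R.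
Proof. by rewrite lee_fin indicE ler0n. Qed.

Lemma scale_kernel_ge0 n x y : 0 <= scale_kernel n x y.
Proof. by rewrite mule_ge0 ?indic_ge0// lee_fin mulr_ge0// indicE ler0n. Qed.

Lemma scale_weight_ge0 n x : 0 <= scale_weight n x.
Proof. by rewrite mule_ge0 ?indic_ge0// lee_fin !mulr_ge0// sqr_ge0. Qed.

Lemma measurable_EFin_indic (B : set (R * R)) : measurable B ->
  measurable_fun [set: R * R] (fun x => (\1_B x : R)%:E).
Proof. by move=> mB; apply: measurableT_comp => //; exact: measurable_indic. Qed.

Lemma measurable_scale_kernel n x : measurable_fun setT (scale_kernel n x).
Proof. by apply: measurable_funeM; apply: measurable_EFin_indic;
  exact: measurable_box. Qed.

Lemma measurable_scale_weight n : measurable_fun setT (scale_weight n).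
Proof. by apply: measurable_funeM; exact: measurable_EFin_indic. Qed.

Lemma integral_scale_kernel n x : \int[mu]_y scale_kernel n x y = scale_weight n x.
Proof.
have k0 : (0 <= A n * \1_(X n) x)%R by rewrite mulr_ge0// indicE ler0n.
have H := (ge0_integralZl_EFin mu measurableT (fun y _ => indic_ge0 (box x (r n)) y)
  (measurable_EFin_indic (measurable_box _ _)) k0).
rewrite [LHS]H.
rewrite integral_indic//; last exact: measurable_box.
rewrite setIT [X in _ * X](_ : _ = mu (box x (r n)))//.
by rewrite leb2_box// /scale_weight -!EFinM; congr (_%:E); ring.
Qed.

Lemma integral_scale_weight n :
  \int[mu]_x scale_weight n x = (A n * (4 * r n ^+ 2))%:E * mu (X n).
Proof.
have k0 : (0 <= A n * (4 * r n ^+ 2))%R by rewrite !mulr_ge0// sqr_ge0.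
have H := (ge0_integralZl_EFin mu measurableT (fun y _ => indic_ge0 (X n) y)
  (measurable_EFin_indic (mX n)) k0).
rewrite [LHS]H.
rewrite integral_indic//; last exact: mX.
by rewrite setIT.
Qed.

Definition series_kernel x y : \bar R := \sum_(n <oo) scale_kernel n x y.

Definition series_weight x : \bar R := \sum_(n <oo) scale_weight n x.

Lemma series_kernel_ge0 x y : 0 <= series_kernel x y.
Proof. by apply: nneseries_ge0 => n _ _; exact: scale_kernel_ge0. Qed.

Lemma series_weight_ge0 x : 0 <= series_weight x.
Proof. by apply: nneseries_ge0 => n _ _; exact: scale_weight_ge0. Qed.

Lemma measurable_series_kernel x : measurable_fun setT (series_kernel x).
Proof.
apply: ge0_emeasurable_sum => [n y _ _|n _]; first exact: scale_kernel_ge0.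
exact: measurable_scale_kernel.
Qed.

Lemma measurable_series_weight : measurable_fun setT series_weight.
Proof.
apply: ge0_emeasurable_sum => [n y _ _|n _]; first exact: scale_weight_ge0.
exact: measurable_scale_weight.
Qed.

Lemma integral_series_kernel x : \int[mu]_y series_kernel x y = series_weight x.
Proof.
rewrite integral_nneseries//.
- by apply: eq_eseriesr => n _; exact: integral_scale_kernel.
- by move=> n; exact: measurable_scale_kernel.
- by move=> n y _; exact: scale_kernel_ge0.
Qed.

Lemma integral_series_weight : \int[mu]_x series_weight x =
  \sum_(n <oo) (A n * (4 * r n ^+ 2))%:E * mu (X n).
Proof.
rewrite integral_nneseries//.
- by apply: eq_eseriesr => n _; exact: integral_scale_weight.
- exact: measurable_scale_weight.
- by move=> n y _; exact: scale_weight_ge0.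
Qed.

Lemma series_kernel_ge n x y : X n x -> (`|y - x| <= r n)%R ->
  (A n)%:E <= series_kernel x y.
Proof.
move=> Xx xy; apply: (@le_trans _ _ (\sum_(0 <= i < n.+1) scale_kernel i x y));
  last first.
  by apply: nneseries_lim_ge => i _ _; exact: scale_kernel_ge0.
rewrite big_nat_recr//= [X in _ + X](_ : _ = (A n)%:E).
  by rewrite leeDr// sume_ge0// => i _; exact: scale_kernel_ge0.
rewrite /scale_kernel !indicE (mem_set Xx).
by have /boxP/mem_set -> := xy; rewrite mulr1 mule1.
Qed.

Lemma series_weight_lty (C q : R) : (0 < q < 1)%R -> (0 <= C)%R ->
  (forall n, (A n * (4 * r n ^+ 2))%:E * mu (X n) <= (C * q ^+ n)%:E) ->
  \int[mu]_x series_weight x < +oo.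
Proof.
move=> /andP[q0 q1] C0 h; rewrite integral_series_weight.
have le_term n : 0 <= (A n * (4 * r n ^+ 2))%:E * mu (X n).
  by rewrite mule_ge0// lee_fin !mulr_ge0// sqr_ge0.
apply: (@le_lt_trans _ _ (C * (1 - q)^-1)%:E); last exact: ltry.
apply: lime_le; first by apply: is_cvg_nneseries => n _ _; exact: le_term.
apply: nearW => n.
apply: (@le_trans _ _ (\sum_(0 <= i < n) (C * q ^+ i)%:E)).
  by apply: lee_sum => i _; exact: h.
rewrite sumEFin lee_fin; apply: (geometric_le_lim n C0 q0).
by rewrite gtr0_norm.
Qed.

End Kernels.

(** * Bounds of the fractional perimeter of the snowflake *)

Section Perimeter.
Context {R : realType}.
Implicit Types (x y : R * R) (k : nat) (s : R).
Local Notation mu := (leb2 R).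
Local Notation len k := (3^-1 ^+ k : R).
Local Notation d := (ln 4 / ln 3 : R).
Local Notation S := (snowflake R).
Local Notation K s x y := ((@edist2 R x y `^ (2 + s))^-1).

Lemma perimeter_inner_ge0 s x :
  (0 <= \int[mu]_(y in ~` S) (K s x y)%:E)%E.
Proof. by apply: integral_ge0 => y _; rewrite lee_fin invr_ge0 powR_ge0. Qed.

Lemma powR_inv_le (a b s : R) : 0 <= s -> 0 < a -> a <= b ->
  (b `^ s)^-1 <= (a `^ s)^-1.
Proof.
move=> s0 a0 ab; have b0 := lt_le_trans a0 ab.
rewrite lef_pV2 ?posrE ?powR_gt0//.
by rewrite ge0_ler_powR ?nnegrE ?(ltW a0) ?(ltW b0).
Qed.

Lemma edist2_gt0 x y : x != y -> 0 < edist2 x y.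
Proof.
by move=> xy; apply: lt_le_trans (norm_le_edist2 x y); rewrite normr_gt0 subr_eq0.
Qed.

(** Only the [y] in the notch box of the same edge are kept; there the distance is at most
    [2 * len k]. *)
Lemma perimeter_inner_ge s k x : 0 < s -> spike_boxes k x ->
  ((((2 * len k) `^ (2 + s))^-1 * (4 * (len k / 200) ^+ 2))%:E <=
    \int[mu]_(y in ~` S) (K s x y)%:E)%E.
Proof.
move=> s0 /bigsetUP[e ek ex]; have l0 := @len_gt0 R k.
have l200 : 0 <= len k / 200 by lra.
rewrite EFinM -(leb2_box (notch_center e) l200).
rewrite -integral_cst; last exact: measurable_box.
apply: ge0_integral_mono => [y _|y _|y].
- by rewrite lee_fin invr_ge0 powR_ge0.
- by rewrite lee_fin invr_ge0 powR_ge0.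
rewrite !patchE; case: ifPn => [/set_mem ey|_]; last first.
  by case: ifPn => // _; rewrite lee_fin invr_ge0 powR_ge0.
have Sy := box_notch_snowflake ek ey; have Sx := box_spike_snowflake ek ex.
rewrite mem_set// lee_fin; apply: powR_inv_le; first lra.
  by apply: edist2_gt0; apply/eqP => xy; apply: Sy; rewrite -xy.
exact: edist2_spike_notch ek ex ey.
Qed.

Lemma frac_perimeter_ge s k : 0 < s ->
  (((2 `^ (2 + s))^-1 / 10000 * (3 / 10000) * (3 `^ s * (4 / 9)) ^+ k)%:E <=
   frac_perimeter s S)%E.
Proof.
move=> s0; have l0 := @len_gt0 R k;
  have p2 : 0 < 2 `^ (2 + s) :> R by exact: powR_gt0.
have -> : (2 `^ (2 + s))^-1 / 10000 * (3 / 10000) * (3 `^ s * (4 / 9)) ^+ k =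
   ((2 * len k) `^ (2 + s))^-1 * (4 * (len k / 200) ^+ 2) * (3 / 10000 * (4 / 9)
     ^+ k).
  rewrite powRM ?(ltW l0)// powR_len exprMn expr_div_n invfM exprVn invrK.
  rewrite (@powRD _ 3) ?pnatr_eq0 ?implybT// (powR_mulrn 2)// exprMn.
  have -> : (3 ^+ 2) ^+ k = (len k ^+ 2)^-1 :> R by rewrite !exprVn invrK exprAC.
  by field; rewrite !gt_eqF.
rewrite EFinM -leb2_spike_boxes -integral_cst; last exact: measurable_boxes.
apply: ge0_integral_mono => [x _|x _|x].
- by rewrite lee_fin mulr_ge0 ?invr_ge0 ?powR_ge0// mulr_ge0 ?sqr_ge0.
- exact: perimeter_inner_ge0.
rewrite !patchE; case: ifPn => [/set_mem sx|_]; last first.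
  by case: ifPn => // _; exact: perimeter_inner_ge0.
rewrite mem_set; first exact: perimeter_inner_ge.
by move: sx => /bigsetUP[e ek ex]; exact: box_spike_snowflake ek ex.
Qed.

(** As [9 / 4] is [3^(2 - d)], the geometric ratio [3^s * (4 / 9)] of both perimeter estimates
    crosses 1 exactly at [s = 2 - d]. *)
Lemma powR3_lt s : (3 `^ s < 9 / 4) = (s < 2 - d).
Proof.
rewrite -powR_codim /powR pnatr_eq0 /= ltr_expR ltr_pM2r//; exact: ln3_gt0.
Qed.

Lemma powR3_gt s : (9 / 4 < 3 `^ s) = (2 - d < s).
Proof.
rewrite -powR_codim /powR pnatr_eq0 /= ltr_expR ltr_pM2r//; exact: ln3_gt0.
Qed.

Lemma frac_perimeter_pinfty s : 2 - d < s -> frac_perimeter s S = +oo%E.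
Proof.
move=> ds; have s0 : 0 < s by have := koch_dim_lt2 (R := R); lra.
move: ds; rewrite -powR3_gt => q1.
have := fun k => frac_perimeter_ge k s0.
set C := _ / 10000 * _; set q := _ * (4 / 9).
have {}q1 : 1 < q by rewrite /q; lra.
have C0 : 0 < C.
  have p2 : 0 < (2 `^ (2 + s))^-1 :> R by rewrite invr_gt0; exact: powR_gt0.
  by rewrite /C; lra.
move: C q C0 q1 => C q C0 q1 lb; apply/eqyP => M M0.
have : `|q^-1| < 1 by rewrite gtr0_norm ?invr_gt0 ?invf_lt1//; lra.
move=> /cvg_expr/cvgr_lt/(_ _ (divr_gt0 C0 M0))[k _ /(_ k (leqnn k))] /= qk.
apply: le_trans (lb k); rewrite lee_fin.
have qk0 : 0 < q ^+ k by apply: exprn_gt0; lra.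
by move: qk; rewrite exprVn ltr_pdivlMr// mulrC ltr_pdivrMr// => /ltW.
Qed.

(* Bounds of the kernel for [3^-(k+1) < |x - y| <= 3^-k] and for
   [3^k <= |x - y| < 3^(k+1)] respectively. *)
Definition near_coef s k : R := (3 `^ (2 + s)) ^+ k.+1.

Definition far_coef s k : R := (3 `^ (2 + s))^-1 ^+ k.

Definition far_radius k : R := 3 ^+ k.+1.

Local Notation near_kernel s :=
  (@series_kernel R (near_coef s) (fun k => len k) (@cover_boxes R)).

Local Notation far_kernel s :=
  (@series_kernel R (far_coef s) far_radius (fun=> box 0 4)).

Local Notation near_weight s :=
  (@series_weight R (near_coef s) (fun k => len k) (@cover_boxes R)).

Local Notation far_weight s :=
  (@series_weight R (far_coef s) far_radius (fun=> box 0 4)).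

Lemma near_coef_ge0 s k : 0 <= near_coef s k.
Proof. by rewrite exprn_ge0 ?powR_ge0. Qed.

Lemma far_coef_ge0 s k : 0 <= far_coef s k.
Proof. by rewrite exprn_ge0 ?invr_ge0 ?powR_ge0. Qed.

Lemma far_radius_ge0 k : 0 <= far_radius k.
Proof. exact: exprn_ge0. Qed.

Lemma len_ge0 k : 0 <= len k.
Proof. exact/ltW/len_gt0. Qed.

Lemma measurable_cover_boxes k : measurable (@cover_boxes R k).
Proof. exact: measurable_boxes. Qed.

Lemma measurable_far_box k : measurable (box (0 : R * R) 4).
Proof. exact: measurable_box. Qed.

(** A single term suffices. When the sup distance is at most 1, a boundary point between [x] and [y]
    puts [x] in the cover boxes of the matching generation; otherwise only the boundedness of the
    snowflake is used for [x]. *)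
Lemma kernel_le_series s x y : 0 < s -> S x -> ~ S y ->
  ((K s x y)%:E <= near_kernel s x y + far_kernel s x y)%E.
Proof.
move=> s0 Sx Sy; have xy : x != y by apply/eqP => xy; apply: Sy; rewrite -xy.
have r0 : 0 < `|x - y| by rewrite normr_gt0 subr_eq0.
have Kr (a : R) : 0 < a -> a <= `|x - y| -> K s x y <= (a `^ (2 + s))^-1.
  by move=> a0 ar; apply: powR_inv_le => //;
    [lra | exact: le_trans ar (norm_le_edist2 x y)].
have [r1|r1] := leP `|x - y| 1.
  have [|k /andP[kr rk]] := @len_scale R `|x - y|; first by rewrite r0.
  rewrite -[leLHS]adde0; apply: leeD; last first.
    by apply: series_kernel_ge0; exact: far_coef_ge0.
  apply: (@le_trans _ _ (near_coef s k)%:E).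
    by rewrite lee_fin /near_coef; have := Kr _ (len_gt0 _) (ltW kr);
      rewrite powR_len exprVn invrK.
  apply: series_kernel_ge => //; first exact: near_coef_ge0.
    have [z zk [xz _]] := frontier_between k Sx Sy.
    apply: near_cover_boxes zk _; have := len_ge0 k; lra.
  by rewrite distrC.
(* Locating the inverse distance between consecutive powers of 1/3 gives
   [3^k <= |x - y| < 3^(k+1)]. *)
have [|k /andP[kr rk]] := @len_scale R `|x - y|^-1.
  by rewrite invr_gt0 r0 invf_le1//= ltW.
rewrite -[leLHS]add0e; apply: leeD; first by apply: series_kernel_ge0;
  exact: near_coef_ge0.
apply: (@le_trans _ _ (far_coef s k)%:E).
  have h : 3 ^+ k <= `|x - y|.
    by rewrite -lef_pV2 ?posrE ?exprn_gt0// -exprVn.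
  by have := Kr _ (exprn_gt0 k (ltr0Sn R 2)) h;
    rewrite lee_fin powRXn// /far_coef exprVn.
apply: series_kernel_ge => //; first exact: far_coef_ge0.
  by apply/boxP; rewrite subr0 leNgt; apply/negP => /far_notin_snowflake.
rewrite distrC /far_radius -lef_pV2 ?posrE ?exprn_gt0//.
by rewrite -exprVn ltW.
Qed.

Lemma near_weight_lty s : 0 < s -> s < 2 - d ->
  (\int[mu]_x near_weight s x < +oo)%E.
Proof.
move=> s0; rewrite -powR3_lt => sd.
have p0 : 0 < 3 `^ s :> R by exact: powR_gt0.
(* The constant 768 is 4 from the area of the [y] box times 192 from [leb2_cover_boxes]; [3^(2 + s)]
   is the extra factor in [near_coef]. *)
apply: (@series_weight_lty _ _ _ _ (near_coef_ge0 s) len_ge0 measurable_cover_boxes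
  (768 * 3 `^ (2 + s)) (3 `^ s * (4 / 9))).
- by apply/andP; split; [apply: mulr_gt0; lra | lra].
- by apply: mulr_ge0; [lra | exact: powR_ge0].
move=> k; apply: le_trans (lee_wpmul2l _ (leb2_cover_boxes k)) _.
  by rewrite lee_fin mulr_ge0 ?near_coef_ge0// mulr_ge0// sqr_ge0.
rewrite -EFinM lee_fin /near_coef exprS powRD ?pnatr_eq0 ?implybT// (powR_mulrn
  2)//.
rewrite (exprMn k (3 ^+ 2)) (exprMn k (3 `^ s)).
have -> : (3 ^+ 2) ^+ k = (len k ^+ 2)^-1 :> R by rewrite !exprVn invrK exprAC.
by rewrite le_eqVlt; apply/orP; left; apply/eqP; field; rewrite gt_eqF ?len_gt0.
Qed.

Lemma far_weight_lty s : 0 < s -> (\int[mu]_x far_weight s x < +oo)%E.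
Proof.
move=> s0; have p1 : 1 < 3 `^ s :> R.
  by rewrite -[ltLHS](powRr0 3) /powR pnatr_eq0 /= ltr_expR ltr_pM2r ?ln3_gt0.
(* The area of the [y] box is [36 * 9^k] and that of [box 0 4] is 64, with product [2304 * 9^k];
   [far_coef] cancels [9^k] and leaves the ratio [3^-s]. *)
apply: (@series_weight_lty _ _ _ _ (far_coef_ge0 s) far_radius_ge0
  measurable_far_box
  2304 (3 `^ s)^-1).
- by rewrite invr_gt0 invf_lt1; lra.
- by lra.
move=> k; rewrite leb2_box; last lra.
rewrite -EFinM lee_fin /far_coef /far_radius powRD ?pnatr_eq0 ?implybT//
  (powR_mulrn 2)//.
rewrite (exprS 3 k) invfM exprMn.
have -> : (3 ^+ 2)^-1 ^+ k = (3 ^+ k ^+ 2)^-1 :> R by rewrite exprVn exprAC.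
have t0 : 0 < 3 ^+ k :> R by rewrite exprn_gt0.
move: (3 ^+ k) t0 ((3 `^ s)^-1 ^+ k) => t t0 p.
by rewrite le_eqVlt; apply/orP; left; apply/eqP; field; rewrite gt_eqF.
Qed.

(** The sum of the two kernels dominates; integrating it over the whole plane in [y], then in [x],
    gives the two finite weights. *)
Lemma frac_perimeter_lty s : 0 < s < 2 - d -> (frac_perimeter s S < +oo)%E.
Proof.
move=> /andP[s0 sd].
have N0 := near_coef_ge0 s; have F0 := far_coef_ge0 s.
have Nk0 x y : (0 <= near_kernel s x y)%E by exact: series_kernel_ge0.
have Fk0 x y : (0 <= far_kernel s x y)%E by exact: series_kernel_ge0.
have Nw0 x : (0 <= near_weight s x)%E by exact: (series_weight_ge0 _ N0 len_ge0).
have Fw0 x : (0 <= far_weight s x)%E by exact: (series_weight_ge0 _ F0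
  far_radius_ge0).
have NE x : (near_weight s x = \int[mu]_y near_kernel s x y)%E.
  by rewrite (integral_series_kernel _ N0 len_ge0).
have FE x : (far_weight s x = \int[mu]_y far_kernel s x y)%E.
  by rewrite (integral_series_kernel _ F0 far_radius_ge0).
apply: (@le_lt_trans _ _ (\int[mu]_x (near_weight s x + far_weight s x)))%E.
  apply: ge0_integral_mono => [x _|x _|x].
  - exact: perimeter_inner_ge0.
  - by rewrite adde_ge0.
  rewrite patch_setT patchE; case: ifPn => [/set_mem Sx|_];
    last by rewrite adde_ge0.
  rewrite NE FE -ge0_integralD//; last 2 first.
  - exact: measurable_series_kernel.
  - exact: measurable_series_kernel.
  apply: ge0_integral_mono => [y _|y _|y].
  - by rewrite lee_fin invr_ge0 powR_ge0.
  - by rewrite adde_ge0.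
  rewrite patch_setT patchE; case: ifPn => [/set_mem Sy|_];
    last by rewrite adde_ge0.
  exact: kernel_le_series.
rewrite ge0_integralD//; last 2 first.
- exact: (measurable_series_weight N0 len_ge0 measurable_cover_boxes).
- exact: (measurable_series_weight F0 far_radius_ge0 measurable_far_box).
by apply: lte_add_pinfty; [exact: near_weight_lty | exact: far_weight_lty].
Qed.

Lemma dimF_snowflake : dimF S = d%:E.
Proof.
have d1 := koch_dim_gt1 (R := R); have d2 := koch_dim_lt2 (R := R).
rewrite /dimF (_ : ereal_sup _ = (2 - d)%:E).
  by rewrite -EFinB; congr (_%:E); lra.
apply/eqP; rewrite eq_le; apply/andP; split.
  apply: ge_ereal_sup => _ [s [s01 sS] <-]; rewrite lee_fin leNgt; apply/negP.
  by move=> /frac_perimeter_pinfty sE; rewrite sE in sS.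
apply/lee_subgt0Pr => e e0; have [h|h] := ltP 0 (2 - d - e).
  apply: ereal_sup_ubound; exists (2 - d - e) => //; split; first lra.
  by apply: frac_perimeter_lty; lra.
(* When [2 - d - e] is not positive it is no admissible [s]; half of [2 - d] is admissible and
   larger. *)
apply: (@le_trans _ _ ((2 - d) / 2)%:E); first by rewrite lee_fin; lra.
apply: ereal_sup_ubound; exists ((2 - d) / 2) => //; split; first lra.
by apply: frac_perimeter_lty; lra.
Qed.

End Perimeter.

Theorem proposition0p7 (R : realType) :
  [/\ has_minkowski_dim (frontier (snowflake R)) (ln 4 / ln 3)%:E,
      dimF (snowflake R) = (ln 4 / ln 3)%:E,
      (forall s : R, 0 < s < 2 - ln 4 / ln 3 ->
         (frac_perimeter s (snowflake R) < +oo)%E)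
    & (forall s : R, 2 - ln 4 / ln 3 < s < 1 ->
         frac_perimeter s (snowflake R) = +oo%E)].
Proof.
split.
- exact: snowflake_minkowski_dim.
- exact: dimF_snowflake.
- exact: frac_perimeter_lty.
- by move=> s /andP[ds _]; exact: frac_perimeter_pinfty.
Qed.
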